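(* Let $\theta\ge0$, $\omega\ge0$, $a\ge0$, $b\ge0$ satisfy $b\,\omega^{-1}(e^{a\omega}-1)<1$. Then $(\varphi,f)\mapsto\varphi(\Delta_{\theta,\omega})f$ is a continuous map from $\mathcal L^+_a\times\mathcal L^+_b$ into $\mathcal L^+_c$, where $c=b\,e^{a\omega}\bigl(1-b\,\omega^{-1}(e^{a\omega}-1)\bigr)^{-1}$.
   Context: $D=\partial/\partial z$. $\Delta_{\theta,\omega}=(\theta+\omega z)D+zD^2$, and for entire $\varphi,f$, $\varphi(\Delta_{\theta,\omega})f=\sum_{k\ge0}\frac{\varphi^{(k)}(0)}{k!}\Delta_{\theta,\omega}^kf$. For $b>0$, $\|f\|_b=\sup_{k\in\mathbb N_0}b^{-k}|f^{(k)}(0)|$; for $a\ge0$, $\mathcal A_a$ is the set of entire $f$ with $\|f\|_b<\infty$ for all $b>a$, with the Fréchet topology of these norms. $\mathcal L^+$ is the set of entire functions of the form $f(z)=Cz^m e^{\alpha z}\prod_{j=1}^\infty(1+\beta_jz)$ with $C\in\mathbb C$, $m\in\mathbb N_0$, $\alpha\ge0$, $\beta_j\ge\beta_{j+1}\ge0$, $\sum_j\beta_j<\infty$ (Laguerre entire functions). $\mathcal L^+_a=\mathcal L^+\cap\mathcal A_a$, with the topology induced from $\mathcal A_a$. When $\omega=0$, $\omega^{-1}(e^{a\omega}-1)$ means $a$. *)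

(* Defs.v *)
From HB Require Import structures.
From mathcomp Require Import all_boot all_order all_algebra.
From mathcomp Require Import all_classical all_reals all_analysis.
From mathcomp Require Import complex.
Set Implicit Arguments. Unset Strict Implicit. Unset Printing Implicit Defensive.
Import Order.TTheory GRing.Theory Num.Theory.
Import numFieldNormedType.Exports.
Local Open Scope classical_set_scope.
Local Open Scope ring_scope.
Local Open Scope complex_scope.

Section Defs.
Variable R : realType.
Local Notation C := R[i].

Definition cvgC (u : nat -> C) (l : C) : Prop :=
  ((fun n => complex.Re (u n)) @ \oo --> complex.Re l) /\
  ((fun n => complex.Im (u n)) @ \oo --> complex.Im l).

(* Limit of a complex sequence (meaningful when it converges). *)
Definition climn (u : nat -> C) : C :=
  Complex (limn (fun n => complex.Re (u n))) (limn (fun n => complex.Im (u n))).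

Definition cexp (w : C) : C :=
  Complex (expR (complex.Re w) * cos (complex.Im w))
          (expR (complex.Re w) * sin (complex.Im w)).

(* An entire function is represented by its Taylor coefficients at 0,
   f(z) = sum_k f_k z^k, i.e. f_k = f^(k)(0)/k!. *)
Definition tseries := nat -> C.

Definition entire (f : tseries) : Prop :=
  forall z : C, exists l : C, cvgC (fun n => \sum_(k < n) f k * z ^+ k) l.

Definition deriv0 (f : tseries) (k : nat) : C := (k`!)%:R * f k.

(* D = d/dz and multiplication by z, acting on Taylor coefficients *)
Definition Dop (f : tseries) : tseries := fun k => (k.+1)%:R * f k.+1.
Definition Zop (f : tseries) : tseries := fun k => if k is k'.+1 then f k' else 0.
Definition addT (f g : tseries) : tseries := fun k => f k + g k.
Definition scaleT (c : C) (f : tseries) : tseries := fun k => c * f k.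
Definition subT (f g : tseries) : tseries := fun k => f k - g k.

Definition Delta (theta omega : R) (f : tseries) : tseries :=
  addT (addT (scaleT theta%:C (Dop f)) (scaleT omega%:C (Zop (Dop f))))
       (Zop (Dop (Dop f))).

(* phi(Delta) f = sum_k phi^(k)(0)/k! Delta^k f, the series being taken
   coefficientwise (the n-th Taylor coefficient of the result is the sum of
   the series of n-th Taylor coefficients). *)
Definition phiDelta_partial (theta omega : R) (phi f : tseries) (N : nat) : tseries :=
  fun n => \sum_(k < N) phi k * iter k (Delta theta omega) f n.
Definition phiDelta (theta omega : R) (phi f : tseries) : tseries :=
  fun n => climn (fun N => phiDelta_partial theta omega phi f N n).

Definition normb (b : R) (f : tseries) : \bar R :=
  ereal_sup (range (fun k : nat => (b ^- k * Normc.normc (deriv0 f k))%:E)).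

Definition inA (a : R) (f : tseries) : Prop :=
  entire f /\ forall b : R, a < b -> (normb b f < +oo)%E.

Definition Laguerre (f : tseries) : Prop :=
  exists (C0 : C) (m : nat) (alpha : R) (beta : nat -> R),
    0 <= alpha /\
    (forall j, 0 <= beta j.+1 <= beta j) /\
    cvgn (series beta) /\
    exists P : C -> C,
      forall z : C,
        cvgC (fun n => \prod_(j < n) (1 + (beta j)%:C * z)) (P z) /\
        cvgC (fun n => \sum_(k < n) f k * z ^+ k)
             (C0 * z ^+ m * cexp ((alpha%:C) * z) * P z).

Definition inLa (a : R) (f : tseries) : Prop := Laguerre f /\ inA a f.

Definition qfun (omega a : R) : R :=
  if omega == 0 then a else (expR (a * omega) - 1) / omega.

Definition cconst (omega a b : R) : R :=
  b * expR (a * omega) / (1 - b * qfun omega a).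

End Defs.

(* Main.v *)
(* Growth: coefficientwise phi(Delta) f is dominated by a multiple of
   exp(a' Delta) e^{b' z} = (1 - b' q(a'))^(-theta) e^{c(a', b') z}, which is compared with
   the partial sums of the exponential series through the differential equation
   v' = Delta v; with a' > a and b' > b close to a and b this bounds the norms, and
   continuity follows by bilinearity.
   Zeros: kappa + mu Delta (kappa, mu >= 0) preserves polynomials whose roots are all
   nonpositive reals, hence so does phi(Delta) for every such polynomial phi.  A Laguerre
   entire function is, up to a constant, a coefficientwise nondecreasing limit of such
   polynomials, so phi(Delta) f is too by monotone convergence; and an entire limit of
   this kind is again a Laguerre entire function (Laguerre, Polya). *)
Require Import Defs.
From HB Require Import structures.
From mathcomp Require Import all_boot all_order all_algebra.
From mathcomp Require Import all_classical all_reals all_analysis.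
From mathcomp Require Import complex ring lra.
Import Order.TTheory GRing.Theory Num.Theory.
Import numFieldNormedType.Exports.
Local Open Scope classical_set_scope.
Local Open Scope ring_scope.
Local Open Scope complex_scope.
Set Implicit Arguments. Unset Strict Implicit. Unset Printing Implicit Defensive.

(** A Laguerre entire function is a constant times a series with nonnegative coefficients, and
    [Delta] acts on coefficients with nonnegative weights. Limits and sums are therefore exchanged
    by monotonicity, without locally uniform convergence. Two obstacles shape the rest. Membership
    in A_a controls only the norms of index above a, so estimates are made at perturbed parameters
    a' > a and b' > b, which the strict inequality b q(a) < 1 leaves room for. And the closure of
    the class under limits, classically a matter of Hurwitz and Hadamard, is obtained from
    coefficients: the sum of the reciprocal roots is a ratio of two consecutive coefficients, so it
    stays bounded, and compactness along one ultrafilter gives the limits of all reciprocals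
    simultaneously. In the limit a part of that sum may be spread over ever more, ever smaller
    reciprocals; it reappears as the factor e^{alpha z}. Finally, a function is its sequence of
    Taylor coefficients, whereas [Laguerre] constrains only values; uniqueness of power series links
    the two. *)

Section ComplexLimits.
Variable R : realType.
Local Notation C := R[i].
Local Notation normc := (@Normc.normc R).

Lemma normcE2 (z : C) : normc z = Num.sqrt (complex.Re z ^+ 2 + complex.Im z ^+ 2).
Proof. by case: z. Qed.

Lemma normc_ge0 (z : C) : 0 <= normc z.
Proof. by rewrite normcE2 sqrtr_ge0. Qed.

Lemma normc_real (x : R) : normc x%:C = `|x|.
Proof. by rewrite normcE2 /= expr0n /= addr0 sqrtr_sqr. Qed.

Lemma normcX (z : C) n : normc (z ^+ n) = normc z ^+ n.
Proof.
elim: n => [|n IH]; first by rewrite !expr0 Normc.normc1.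
by rewrite !exprS Normc.normcM IH.
Qed.

Lemma normc_nat n : normc n%:R = n%:R.
Proof. by rewrite -(rmorph_nat (real_complex R)) normc_real normr_nat. Qed.

Lemma normc_sum I (r : seq I) (P : pred I) (F : I -> C) :
  normc (\sum_(i <- r | P i) F i) <= \sum_(i <- r | P i) normc (F i).
Proof.
elim/big_rec2: _ => [|i x y _ IH]; first by rewrite Normc.normc0.
exact: le_trans (le_normcD _ _) (lerD _ _).
Qed.

Lemma Re_le_normc (z : C) : `|complex.Re z| <= normc z.
Proof.
rewrite -sqrtr_sqr normcE2 ler_wsqrtr // lerDl sqr_ge0 //.
Qed.

Lemma Im_le_normc (z : C) : `|complex.Im z| <= normc z.
Proof.
rewrite -sqrtr_sqr normcE2 ler_wsqrtr // lerDr sqr_ge0 //.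
Qed.

Lemma normc_leD (z : C) : normc z <= `|complex.Re z| + `|complex.Im z|.
Proof.
rewrite normcE2 -[leRHS]ger0_norm ?addr_ge0// -sqrtr_sqr ler_sqrt ?sqr_ge0//.
rewrite sqrrD !real_normK ?num_real// addrAC lerDl.
by rewrite mulrn_wge0// mulr_ge0.
Qed.

Lemma normcB (x y : C) : normc (x - y) = normc (y - x).
Proof. by rewrite -normcN opprB. Qed.

Lemma ReM (x y : C) : complex.Re (x * y) =
  complex.Re x * complex.Re y - complex.Im x * complex.Im y.
Proof. by case: x; case: y. Qed.

Lemma ImM (x y : C) : complex.Im (x * y) =
  complex.Re x * complex.Im y + complex.Im x * complex.Re y.
Proof. by case: x; case: y. Qed.

Lemma ReD (x y : C) : complex.Re (x + y) = complex.Re x + complex.Re y.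
Proof. by case: x; case: y. Qed.

Lemma ImD (x y : C) : complex.Im (x + y) = complex.Im x + complex.Im y.
Proof. by case: x; case: y. Qed.

Lemma ReN (x : C) : complex.Re (- x) = - complex.Re x.
Proof. by case: x. Qed.

Lemma ImN (x : C) : complex.Im (- x) = - complex.Im x.
Proof. by case: x. Qed.

Lemma ReB (x y : C) : complex.Re (x - y) = complex.Re x - complex.Re y.
Proof. by case: x; case: y. Qed.

Lemma ImB (x y : C) : complex.Im (x - y) = complex.Im x - complex.Im y.
Proof. by case: x; case: y. Qed.

Section FilterLimits.
Variables (T : Type) (F : set_system T).
Context {FF : Filter F}.

(** The filter is arbitrary because roots converge only along an ultrafilter; at [\oo] this unfolds
    to [cvgC], so the same lemmas serve both. *)
Definition cvgCF (u : T -> C) (l : C) : Prop :=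
  ((fun n => complex.Re (u n)) @ F --> complex.Re l) /\
  ((fun n => complex.Im (u n)) @ F --> complex.Im l).

Lemma cvgCF_cst l : cvgCF (fun=> l) l.
Proof. by split; exact: cvg_cst. Qed.

Lemma cvgCFD u v k l : cvgCF u k -> cvgCF v l -> cvgCF (fun n => u n + v n) (k + l).
Proof.
move=> [ur ui] [vr vi]; split.
  by rewrite raddfD /=; under eq_fun do rewrite raddfD /=; exact: cvgD.
by rewrite raddfD /=; under eq_fun do rewrite raddfD /=; exact: cvgD.
Qed.

Lemma cvgCFN u k : cvgCF u k -> cvgCF (fun n => - u n) (- k).
Proof.
move=> [ur ui]; split.
  by rewrite raddfN /=; under eq_fun do rewrite raddfN /=; exact: cvgN.
by rewrite raddfN /=; under eq_fun do rewrite raddfN /=; exact: cvgN.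
Qed.

Lemma cvgCFB u v k l : cvgCF u k -> cvgCF v l -> cvgCF (fun n => u n - v n) (k - l).
Proof. by move=> uk vl; apply: cvgCFD => //; exact: cvgCFN. Qed.

Lemma cvgCFM u v k l : cvgCF u k -> cvgCF v l -> cvgCF (fun n => u n * v n) (k * l).
Proof.
move=> [ur ui] [vr vi]; split.
  by rewrite ReM; under eq_fun do rewrite ReM; apply: cvgB; exact: cvgM.
by rewrite ImM; under eq_fun do rewrite ImM; apply: cvgD; exact: cvgM.
Qed.

Lemma cvgCF_real (u : T -> R) (l : R) : u @ F --> l -> cvgCF (fun n => (u n)%:C) l%:C.
Proof. by move=> ul; split => //=; exact: cvg_cst. Qed.

Lemma cvgCF_prod (I : Type) (r : seq I) (u : I -> T -> C) (l : I -> C) :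
  (forall i, cvgCF (u i) (l i)) ->
  cvgCF (fun n => \prod_(i <- r) u i n) (\prod_(i <- r) l i).
Proof.
move=> ul; elim: r => [|i r IH].
  by rewrite big_nil; under eq_fun do rewrite big_nil; exact: cvgCF_cst.
by rewrite big_cons; under eq_fun do rewrite big_cons; exact: cvgCFM.
Qed.

Lemma cvg_compose (h : R -> R) (u : T -> R) (l : R) : continuous h ->
  u @ F --> l -> (fun n => h (u n)) @ F --> h l.
Proof. by move=> hc ul; exact: (@continuous_cvg _ _ _ F _ u h l (hc l) ul). Qed.

Lemma cvgCF_cexp u l : cvgCF u l -> cvgCF (fun n => cexp (u n)) (cexp l).
Proof.
move=> [ur ui]; split => /=; apply: cvgM.
- by apply: cvg_compose => //; exact: continuous_expR.
- by apply: cvg_compose => //; exact: continuous_cos.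
- by apply: cvg_compose => //; exact: continuous_expR.
- by apply: cvg_compose => //; exact: continuous_sin.
Qed.

Lemma cvgCF_normc u l : cvgCF u l -> (fun n => normc (u n)) @ F --> normc l.
Proof.
move=> [ur ui]; rewrite normcE2; under eq_fun do rewrite normcE2.
apply: (@cvg_compose Num.sqrt); first exact: sqrt_continuous.
by apply: cvgD; exact: cvgM.
Qed.

Lemma cvgCF_norm0 (u : T -> C) (l : C) : (fun n => normc (u n - l)) @ F --> (0 : R) -> cvgCF u l.
Proof.
move=> h; split.
  apply: cvg_sub0; last exact: (cvg_cst (complex.Re l)).
  apply: norm_cvg0; apply: (squeeze_cvgr _ (cvg_cst 0) h).
  by apply: nearW => n; rewrite normr_ge0 /=; have := Re_le_normc (u n - l); rewrite ReB.
apply: cvg_sub0; last exact: (cvg_cst (complex.Im l)).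
apply: norm_cvg0; apply: (squeeze_cvgr _ (cvg_cst 0) h).
by apply: nearW => n; rewrite normr_ge0 /=; have := Im_le_normc (u n - l); rewrite ImB.
Qed.

Lemma cvgCF_squeeze (u : T -> C) (l : C) (e : T -> R) :
  (\forall n \near F, normc (u n - l) <= e n) -> e @ F --> (0 : R) -> cvgCF u l.
Proof.
move=> ue e0; apply: cvgCF_norm0; apply: (squeeze_cvgr _ (cvg_cst 0) e0).
by apply: filterS ue => n ->; rewrite normc_ge0.
Qed.

End FilterLimits.

Lemma cvgCF_unique T (F : set_system T) {FF : ProperFilter F} u k l :
  cvgCF F u k -> cvgCF F u l -> k = l.
Proof.
move=> [ur ui] [vr vi]; apply/eqP; rewrite eq_complex; apply/andP; split; apply/eqP.
  exact: (cvg_unique _ ur vr).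
exact: (cvg_unique _ ui vi).
Qed.

Lemma cvgC_sub (F : set_system nat) {FF : Filter F} u l :
  \oo `<=` F -> cvgC u l -> cvgCF F u l.
Proof.
move=> sF [ur ui]; split.
  by apply: (cvg_trans _ ur) => A; exact: sF.
by apply: (cvg_trans _ ui) => A; exact: sF.
Qed.

Lemma cvgC_climn (u : nat -> C) (l : C) : cvgC u l -> climn u = l.
Proof.
case: l => l1 l2 [/= h1 h2]; rewrite /climn.
by congr Complex; apply/cvg_lim.
Qed.

Lemma cvgC_normc_le (u : nat -> C) (l : C) (M : R) : cvgC u l ->
  (forall n, normc (u n) <= M) -> normc l <= M.
Proof.
move=> ul uM; have h := @cvgCF_normc _ \oo _ _ _ ul.
rewrite -(cvg_lim _ (h _))//; apply: limr_le; first by apply/cvg_ex; exists (normc l); exact: h.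
exact: nearW.
Qed.

End ComplexLimits.

(** * Polynomials with nonpositive roots *)

Section RealRooted.
Variable R : realType.
Local Notation C := R[i].

Definition nonpos_rooted (p : {poly R}) : Prop :=
  exists (c : R) (rs : seq R), all (fun r => 0 <= r) rs /\
    p = c *: \prod_(r <- rs) ('X + r%:P).

Lemma nonpos_rooted0 : nonpos_rooted 0.
Proof. by exists 0, [::]; split => //; rewrite scale0r. Qed.

Lemma nonpos_rootedC c : nonpos_rooted c%:P.
Proof. by exists c, [::]; split => //; rewrite big_nil -mul_polyC mulr1. Qed.

Lemma nonpos_rootedM p q :
  nonpos_rooted p -> nonpos_rooted q -> nonpos_rooted (p * q).
Proof.
move=> [c [rs [hr ->]]] [d [ss [hs ->]]]; exists (c * d), (rs ++ ss); split.
  by rewrite all_cat hr.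
by rewrite big_cat /= -scalerAr -scalerAl scalerA mulrC.
Qed.

Lemma nonpos_rootedX p n : nonpos_rooted p -> nonpos_rooted (p ^+ n).
Proof.
move=> hp; elim: n => [|n IH]; first by rewrite expr0 -polyC1; exact: nonpos_rootedC.
by rewrite exprS; exact: nonpos_rootedM.
Qed.

Lemma nonpos_rooted_prod I (r : seq I) (F : I -> {poly R}) :
  (forall i, nonpos_rooted (F i)) -> nonpos_rooted (\prod_(i <- r) F i).
Proof.
move=> hF; apply: big_ind => //; last exact: nonpos_rootedM.
by rewrite -polyC1; exact: nonpos_rootedC.
Qed.

Lemma nonpos_rooted_polyX : nonpos_rooted 'X.
Proof.
exists 1, [:: 0]; split; first by rewrite /= lexx.
by rewrite big_seq1 scale1r polyC0 addr0.
Qed.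

Lemma nonpos_rooted_1DZX b : 0 <= b -> nonpos_rooted (1 + b *: 'X).
Proof.
rewrite le_eqVlt => /predU1P[<-|b0].
  by rewrite scale0r addr0 -polyC1; exact: nonpos_rootedC.
exists b, [:: b^-1]; split; first by rewrite /= invr_ge0 ltW.
by rewrite big_seq1 scalerDr addrC -!mul_polyC -polyCM divff ?gt_eqF.
Qed.


Lemma sum_sqr_le I (r : seq I) (x : I -> R) : (forall i, 0 <= x i) ->
  \sum_(i <- r) x i ^+ 2 <= (\sum_(i <- r) x i) ^+ 2.
Proof.
move=> x0; elim: r => [|i r IH]; first by rewrite !big_nil expr0n.
rewrite !big_cons; have : 0 <= \sum_(k <- r) x k by apply: sumr_ge0.
have := x0 i; move: IH; set S := \sum_(_ <- _) _; set Q := \sum_(_ <- _) _.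
by move=> *; nra.
Qed.

Lemma sum_sqr_lt I i j (r : seq I) (x : I -> R) : (forall i, 0 < x i) ->
  \sum_(k <- i :: j :: r) x k ^+ 2 < (\sum_(k <- i :: j :: r) x k) ^+ 2.
Proof.
move=> x0; have x0' k : 0 <= x k by exact: ltW.
have := sum_sqr_le r x0'; have : 0 <= \sum_(k <- r) x k by apply: sumr_ge0.
rewrite !big_cons; have := x0 i; have := x0 j.
set S := \sum_(_ <- _) _; set Q := \sum_(_ <- _) _ => *.
have : 0 < x i * x j by rewrite mulr_gt0.
have : 0 <= (x i + x j) * S by rewrite mulr_ge0 ?addr_ge0.
by move=> *; nra.
Qed.

(* Subtracting the two sides leaves [sum_i x_i (Y - y_i)^2 + sum_i (X - x_i) y_i^2]. *)
Lemma sum_pairs_lower I (r : seq I) (x y : I -> R) (X := \sum_(i <- r) x i)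
    (Y := \sum_(i <- r) y i) : (forall i, 0 <= x i) ->
  X * (X ^+ 2 - \sum_(i <- r) x i ^+ 2) <=
  (X ^+ 2 + Y ^+ 2) * X - X * (\sum_(i <- r) (x i ^+ 2 - y i ^+ 2)) -
  Y * (\sum_(i <- r) (x i * y i *+ 2)).
Proof.
move=> x0; rewrite sumrB.
have h1 : 0 <= \sum_(i <- r) x i * (Y - y i) ^+ 2.
  by apply: sumr_ge0 => i _; rewrite mulr_ge0// sqr_ge0.
have h2 : \sum_(i <- r) x i * y i ^+ 2 <= X * \sum_(i <- r) y i ^+ 2.
  rewrite /X; elim: (r) => [|i s IH]; first by rewrite !big_nil mul0r.
  rewrite !big_cons; have := x0 i; have := sqr_ge0 (y i).
  have : 0 <= \sum_(k <- s) x k by apply: sumr_ge0.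
  have : 0 <= \sum_(k <- s) y k ^+ 2 by apply: sumr_ge0 => k _; exact: sqr_ge0.
  move: IH; set a := \sum_(_ <- _) _; set b := \sum_(_ <- _) _; set c := \sum_(_ <- _) _.
  by move=> *; nra.
have h3 : \sum_(i <- r) x i * (Y - y i) ^+ 2 = Y ^+ 2 * X -
    Y * (\sum_(i <- r) (x i * y i *+ 2)) + \sum_(i <- r) x i * y i ^+ 2.
  rewrite /X !mulr_sumr -sumrB -big_split /=; apply: eq_bigr => i _; ring.
rewrite h3 in h1; lra.
Qed.


Definition polyDelta (theta omega : R) (p : {poly R}) : {poly R} :=
  (theta%:P + omega *: 'X) * p^`() + 'X * p^`()^`().

(** The induction steps of [deriv_prod_XDC]: [a] is the new linear factor at z, [b] the value of the
    remaining product, [s] and [q] its sums of inverses and of squared inverses. *)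
Let deriv_prod_rec1 (K : fieldType) (a b s : K) : a != 0 ->
  b + a * (b * s) = a * b * (a^-1 + s).
Proof. by move=> a0; field. Qed.

Let deriv_prod_rec2 (K : fieldType) (a b s q : K) : a != 0 ->
  b * s + b * s + a * (b * (s ^+ 2 - q)) =
  a * b * ((a^-1 + s) ^+ 2 - (a^-1 ^+ 2 + q)).
Proof. by move=> a0; field. Qed.

(** Logarithmic derivatives: p'/p = S and p''/p = S^2 + S', where S' is minus the sum of the squared
    inverses. *)
Lemma deriv_prod_XDC (rs : seq R) (z : C) (p := \prod_(r <- rs) ('X + (r%:C)%:P)) :
  (forall r, r \in rs -> z + r%:C != 0) ->
  let S := \sum_(r <- rs) (z + r%:C)^-1 in
  (p^`()).[z] = p.[z] * S /\
  (p^`()^`()).[z] = p.[z] * (S ^+ 2 - \sum_(r <- rs) (z + r%:C)^-1 ^+ 2).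
Proof.
rewrite /p {p}; elim: rs => [|r rs IH] zr /=.
  by rewrite !big_nil -polyC1 derivC deriv0; split; rewrite !hornerE ?expr0n ?subrr ?mulr0.
have zr0 : z + r%:C != 0 by apply: zr; rewrite mem_head.
have [|IH1 IH2] := IH; first by move=> s sr; apply: zr; rewrite inE sr orbT.
rewrite !big_cons; set p := \prod_(_ <- _) _ in IH1 IH2 *.
set S := \sum_(_ <- _) _ in IH1 IH2 *; set Q := \sum_(_ <- _) _ in IH2 *.
split; rewrite !(derivM, derivD, derivX, derivC, addr0, mul1r) !hornerE IH1 ?IH2 /=.
  exact: (deriv_prod_rec1 p.[z] S zr0).
exact: (deriv_prod_rec2 p.[z] S Q zr0).
Qed.

(** The polynomial splits over the algebraically closed field R[i]; its roots being real, the
    factorization descends to R because the embedding of polynomials is injective. *)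
Lemma all_roots_nonpos (q : {poly R}) :
  (forall z, root (map_poly (real_complex R) q) z ->
    exists2 r : R, 0 <= r & z = - r%:C) ->
  nonpos_rooted q.
Proof.
move=> hq; have [->|q0] := eqVneq q 0; first exact: nonpos_rooted0.
have [zs Ezs] := closed_field_poly_normal (map_poly (real_complex R) q).
pose rs := [seq - complex.Re z | z <- zs].
have zsP z : z \in zs -> z = - (- complex.Re z)%:C /\ 0 <= - complex.Re z.
  move=> zzs; have [|r r0 ->] := hq z.
    rewrite Ezs rootZ ?lead_coef_eq0 ?map_poly_eq0// root_prod_XsubC//.
  by rewrite /= opprK; split.
exists (lead_coef q), rs; split.
  by rewrite all_map; apply/allP => z /zsP[].
apply: (map_poly_inj (real_complex R)); rewrite Ezs lead_coef_map map_polyZ.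
congr (_ *: _); rewrite rmorph_prod big_map big_seq [RHS]big_seq.
apply: eq_bigr => z /zsP[zE _].
by rewrite rmorphD /= map_polyX map_polyC /= {1}zE raddfN /= !opprK.
Qed.

(** Of the two square roots one lies in the right half-plane, unless both are purely imaginary, and
    then z = -(Im w)^2 is on the excluded half-line. *)
Lemma sqrtc_Re_gt0 (z : C) : (forall r : R, 0 <= r -> z <> - r%:C) ->
  exists2 w, w ^+ 2 = z & 0 < complex.Re w.
Proof.
move=> hz; have := sqr_sqrtc z; set w := sqrtc z => wz.
have [w0|w0|w0] := ltgtP 0 (complex.Re w); first by exists w.
  by exists (- w); rewrite ?sqrrN// raddfN /= oppr_gt0.
exfalso; apply: (hz (complex.Im w ^+ 2)); first exact: sqr_ge0.
rewrite -wz; apply/eqP; rewrite eq_complex !expr2 /= ReM ImM -w0.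
by rewrite !mul0r mulr0 sub0r addr0 !eqxx oppr0 eqxx.
Qed.

Lemma nonpos_rootedZ c p : nonpos_rooted p -> nonpos_rooted (c *: p).
Proof. by rewrite -mul_polyC; apply: nonpos_rootedM; exact: nonpos_rootedC. Qed.

Lemma polyDeltaZ theta omega c p :
  polyDelta theta omega (c *: p) = c *: polyDelta theta omega p.
Proof. by rewrite /polyDelta !derivZ -!scalerAr scalerDr. Qed.

Lemma Re_sum I (r : seq I) (u : I -> C) :
  complex.Re (\sum_(i <- r) u i) = \sum_(i <- r) complex.Re (u i).
Proof. by apply: (big_morph _ (fun x y => _) _) => //; case=> ? ? [? ?]. Qed.

Lemma Im_sum I (r : seq I) (u : I -> C) :
  complex.Im (\sum_(i <- r) u i) = \sum_(i <- r) complex.Im (u i).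
Proof. by apply: (big_morph _ (fun x y => _) _) => //; case=> ? ? [? ?]. Qed.

(** The quotient is the inverse of w + r/w, and inversion preserves the right half-plane.
    Explicitly, with w = a + ib, its real part is a (|w|^2 + r) / |w^2 + r|^2. *)
Lemma Re_div_sqrDr (w : C) (r : R) : 0 < complex.Re w -> 0 <= r ->
  0 < complex.Re (w / (w ^+ 2 + r%:C)).
Proof.
case: w => a b /= a0 r0.
rewrite expr2 /=; set n := (_ ^+ 2 + _ ^+ 2)%R.
have nE : n = (a ^+ 2 - b ^+ 2 + r) ^+ 2 + 4 * (a * b) ^+ 2.
  by rewrite /n; ring.
have a2 : 0 < a ^+ 2 by rewrite exprn_gt0.
have n0 : 0 < n.
  rewrite nE; have [->|b0] := eqVneq b 0.
    by rewrite mulr0 expr0n/= mulr0 addr0 subr0 exprn_gt0// ltr_wpDr.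
  by rewrite ltr_wpDl ?sqr_ge0// mulr_gt0// exprn_even_gt0// mulf_neq0// gt_eqF.
rewrite -[ltRHS](_ : a * (a ^+ 2 + b ^+ 2 + r) / n = _).
  by rewrite divr_gt0// mulr_gt0// ltr_wpDr// ltr_wpDr// sqr_ge0.
by field; rewrite gt_eqF.
Qed.

Lemma Re_inv_gt0 (w : C) : 0 < complex.Re w -> 0 < complex.Re w^-1.
Proof.
case: w => a b /= a0; rewrite divr_gt0//.
by rewrite ltr_wpDr ?sqr_ge0// exprn_gt0.
Qed.

Let symbol_identity (K : fieldType) (w th om k m p S Q : K) : w != 0 ->
  p * (k + m * ((th / w + om * w) * (w * S) + (w * S) ^+ 2 - w ^+ 2 * Q)) =
  k * p + m * ((th + om * w ^+ 2) * (p * S) + w ^+ 2 * (p * (S ^+ 2 - Q))).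
Proof. by move=> w0; field. Qed.

(* For a root z off the half-line write z = w^2 with Re w > 0 and put
   u_r = w / (z + r), so that Re u_r > 0.  Dividing by p(z), the equation becomes
   k + m ((theta / w + omega w) U + U^2 - sum u_r^2) = 0 with U = sum u_r; the
   real part of its product with the conjugate of U is a sum of nonnegative terms. *)
Lemma nonpos_rooted_polyDelta (theta omega k m : R) p :
  0 <= theta -> 0 <= omega -> 0 <= k -> 0 <= m ->
  nonpos_rooted p -> nonpos_rooted (k *: p + m *: polyDelta theta omega p).
Proof.
move=> th0 om0 k0 m0 [c [rs [hrs ->]]].
(* With absolute values, positivity of the real parts holds for every real index and not only for
   members of [rs], as the lemmas on sums require. *)
have -> : \prod_(r <- rs) ('X + r%:P) = \prod_(r <- rs) ('X + `|r|%:P).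
  by apply: eq_big_seq => r /(allP hrs) r0; rewrite ger0_norm.
rewrite polyDeltaZ !scalerA ![_ * c]mulrC -!scalerA -scalerDr.
apply: nonpos_rootedZ; set P := \prod_(r <- rs) _; set G := _ + _.
have [->|G0] := eqVneq G 0; first exact: nonpos_rooted0.
apply: all_roots_nonpos => z Gz; apply: contrapT => hz.
move: z Gz hz => /= z Gz hz.
have [|w wz w0] := @sqrtc_Re_gt0 z; first by move=> r r0 zr; apply: hz; exists r.
have zr (r : R) : z + `|r|%:C != 0.
  by apply/eqP => /eqP; rewrite addr_eq0 => /eqP zE; apply: hz; exists `|r|.
pose pC := \prod_(s <- map Num.norm rs) ('X + (s%:C)%:P).
have pE : map_poly (real_complex R) P = pC.
  rewrite /pC big_map rmorph_prod; apply: eq_bigr => r _.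
  by rewrite rmorphD /= map_polyX map_polyC.
have [|D1 D2] := @deriv_prod_XDC (map Num.norm rs) z.
  by move=> _ /mapP[r _ ->].
rewrite -/pC !big_map in D1 D2.
have pz : pC.[z] != 0.
  rewrite /pC horner_prod big_map prodf_seq_neq0; apply/allP => r _ /=.
  by rewrite !hornerE.
pose u (r : R) : C := w / (w ^+ 2 + `|r|%:C).
pose U := \sum_(r <- rs) u r; pose V := \sum_(r <- rs) u r ^+ 2.
pose A := theta%:C / w + omega%:C * w.
have wN0 : w != 0 by apply: contraTneq w0 => ->; rewrite ltxx.
have eq0 : k%:C + m%:C * (A * U + (U ^+ 2 - V)) = 0.
  have GE : map_poly (real_complex R) G = k%:C *: pC + m%:C *:
      ((theta%:C%:P + omega%:C *: 'X) * pC^`() + 'X * pC^`()^`()).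
    rewrite /G /polyDelta -pE !deriv_map.
    rewrite rmorphD /= !map_polyZ rmorphD /= !rmorphM /= rmorphD /=.
    by rewrite map_polyZ !map_polyX map_polyC.
  move: Gz; rewrite /root GE !hornerE D1 D2 => /eqP.
  set S := \sum_(r <- rs) _; set Q := \sum_(r <- rs) _ => Gz.
  have -> : U = w * S by rewrite /U /S mulr_sumr; apply: eq_bigr => r _; rewrite /u wz.
  have -> : V = w ^+ 2 * Q.
    by rewrite /V /Q mulr_sumr; apply: eq_bigr => r _; rewrite /u exprMn wz.
  apply: (mulfI pz); rewrite mulr0 -[RHS]Gz -wz /A.
  exact: symbol_identity.
pose X := \sum_(r <- rs) complex.Re (u r).
pose Y := \sum_(r <- rs) complex.Im (u r).
have x_gt0 r : 0 < complex.Re (u r) by apply: Re_div_sqrDr.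
have AE : complex.Re A = theta * complex.Re w^-1 + omega * complex.Re w.
  by rewrite /A raddfD /= !ReM /= !mul0r !subr0.
have w0' := Re_inv_gt0 w0.
have A0 : 0 <= complex.Re A by rewrite AE addr_ge0// mulr_ge0// ltW.
have key : k * X + m * (complex.Re A * (X ^+ 2 + Y ^+ 2) +
    X * (X ^+ 2 - \sum_(r <- rs) complex.Re (u r) ^+ 2)) <= 0.
  have low := @sum_pairs_lower _ rs _ (fun r => complex.Im (u r)) (fun r => ltW (x_gt0 r)).
  rewrite -/X -/Y in low.
  have V1 : complex.Re V = \sum_(r <- rs) (complex.Re (u r) ^+ 2 - complex.Im (u r) ^+ 2).
    by rewrite /V Re_sum; apply: eq_bigr => r _; rewrite expr2 ReM -!expr2.
  have V2 : complex.Im V = \sum_(r <- rs) (complex.Re (u r) * complex.Im (u r) *+ 2).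
    by rewrite /V Im_sum; apply: eq_bigr => r _; rewrite expr2 ImM mulr2n [X in _ + X]mulrC.
  have U1 : complex.Re U = X by rewrite /U Re_sum.
  have U2 : complex.Im U = Y by rewrite /U Im_sum.
  have e1 := congr1 (@complex.Re R) eq0; have e2 := congr1 (@complex.Im R) eq0.
  move: e1 e2; clearbody A U V.
  rewrite !(ReD, ImD, ReN, ImN, ReM, ImM, expr2) U1 U2 V1 V2 /=.
  move: low; set E := \sum_(r <- rs) (_ - _).
  set D := \sum_(r <- rs) complex.Re (u r) * complex.Im (u r) *+ 2.
  set a1 := complex.Re A; set a2 := complex.Im A.
  move=> low e1 e2.
  (* X times the real part plus Y times the imaginary part is the real part of the equation
     multiplied by the conjugate of U; there Im A cancels, since A U conj(U) = A |U|^2. *)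
  have e3 : k * X + m * (a1 * (X ^+ 2 + Y ^+ 2) + ((X ^+ 2 + Y ^+ 2) * X - X * E - Y * D)) = 0.
    move: (f_equal2 (fun x y => X * x + Y * y) e1 e2) => /=.
    by rewrite !mulr0 addr0 => <-; ring.
  by rewrite -[leRHS]e3 lerD2l ler_wpM2l// lerD2l.
have XQ : 0 <= X * (X ^+ 2 - \sum_(r <- rs) complex.Re (u r) ^+ 2).
  rewrite mulr_ge0 ?sumr_ge0// => [r _|]; first exact: ltW.
  by rewrite subr_ge0; apply: sum_sqr_le => r; exact: ltW.
(* It remains to show G = 0. If P is constant, the equation itself gives k = 0. Otherwise all terms
   of [key] are nonnegative and hence vanish: k = 0, and either m = 0 or theta = omega = 0. In the
   latter case a linear P has zero second derivative, and two or more roots contradict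
   [sum_sqr_lt]. *)
move/negP: G0; apply; rewrite /G.
have [rs0|[r [s rsE]]] : rs = [::] \/ exists r s, rs = r :: s.
  by case: (rs) => [|r s]; [left|right; exists r, s].
  move: eq0; rewrite /U /V /P rs0 !big_nil mulr0 add0r expr0n /= subrr mulr0 addr0.
  move=> /(congr1 (@complex.Re R)) /= ->.
  by rewrite scale0r /polyDelta -polyC1 derivC deriv0 !mulr0 addr0 scaler0 addr0.
have X0 : 0 < X by rewrite /X rsE big_cons ltr_wpDr// sumr_ge0// => i _; exact: ltW.
have XY0 : 0 < X ^+ 2 + Y ^+ 2 by rewrite ltr_wpDr ?sqr_ge0// exprn_gt0.
have k_eq0 : k = 0.
  have : 0 <= m * (complex.Re A * (X ^+ 2 + Y ^+ 2) +
      X * (X ^+ 2 - \sum_(r <- rs) complex.Re (u r) ^+ 2)).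
    by rewrite mulr_ge0// addr_ge0// mulr_ge0// ltW.
  by move=> ?; apply: le_anti; rewrite k0 andbT -(pmulr_lle0 _ X0); lra.
have [->|mN0] := eqVneq m 0; first by rewrite k_eq0 !scale0r addr0.
have m_gt0 : 0 < m by rewrite lt_def mN0.
have A1XY : 0 <= complex.Re A * (X ^+ 2 + Y ^+ 2) by rewrite mulr_ge0// ltW.
move: key; rewrite k_eq0 mul0r add0r pmulr_rle0// => key.
have A_eq0 : complex.Re A = 0.
  by apply: le_anti; rewrite A0 andbT -(pmulr_lle0 _ XY0); lra.
have thw : 0 <= theta * complex.Re w^-1 by rewrite mulr_ge0// ltW.
have omw : 0 <= omega * complex.Re w by rewrite mulr_ge0// ltW.
have th_eq0 : theta = 0.
  by apply: le_anti; rewrite th0 andbT -(pmulr_lle0 _ w0'); lra.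
have om_eq0 : omega = 0.
  by apply: le_anti; rewrite om0 andbT -(pmulr_lle0 _ w0); lra.
have XQ_eq0 : X ^+ 2 - \sum_(r <- rs) complex.Re (u r) ^+ 2 <= 0.
  by rewrite -(pmulr_rle0 _ X0); lra.
rewrite /P th_eq0 om_eq0 /polyDelta !(scale0r, polyC0, addr0, mul0r, add0r).
case: s rsE => [|r' s] rsE.
  by rewrite rsE big_seq1 derivD derivX derivC addr0 -polyC1 derivC mulr0 scaler0.
have := @sum_sqr_lt _ r r' s _ x_gt0; rewrite -rsE -/X.
by rewrite -subr_gt0 ltNge XQ_eq0.
Qed.

End RealRooted.

(** * Monotone polynomial approximation *)

Section MonotoneApproximation.
Variable R : realType.

Lemma nondecreasing_seq_le_lim (u : nat -> R) (l : R) : (forall n, u n <= u n.+1) ->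
  u @ \oo --> l -> forall n, u n <= l.
Proof.
move=> u_le ul n; rewrite -(cvg_lim _ ul)//; apply: nondecreasing_cvgn_le.
  exact/nondecreasing_seqP.
by apply/cvg_ex; exists l.
Qed.

Lemma cvg_le_cst (F : set_system nat) {FF : ProperFilter F} (u : nat -> R) (l M : R) :
  u @ F --> l -> (forall n, u n <= M) -> l <= M.
Proof. by move=> ul uM; apply: (closed_cvg _ (@closed_le R M) _ _ ul); apply: nearW. Qed.

Lemma cvg_ge_cst (F : set_system nat) {FF : ProperFilter F} (u : nat -> R) (l M : R) :
  u @ F --> l -> (forall n, M <= u n) -> M <= l.
Proof. by move=> ul uM; apply: (closed_cvg _ (@closed_ge R M) _ _ ul); apply: nearW. Qed.

Lemma nondecreasing_bounded_cvg (u : nat -> R) (M : R) : (forall n, u n <= u n.+1) ->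
  (forall n, u n <= M) -> exists2 l : R, u @ \oo --> l & l <= M.
Proof.
move=> u_le uM; have cu : cvgn u.
  apply: nondecreasing_is_cvgn; first exact/nondecreasing_seqP.
  by exists M => _ [n _ <-].
by exists (limn u) => //; exact: (cvg_le_cst cu).
Qed.

Lemma cvg_sum_seq T (F : set_system T) {FF : Filter F} I (r : seq I)
    (u : I -> T -> R) (l : I -> R) :
  (forall i, u i @ F --> l i) ->
  (fun N => \sum_(i <- r) u i N) @ F --> \sum_(i <- r) l i.
Proof.
move=> ul; elim: r => [|i r IH].
  by rewrite big_nil; under eq_fun do rewrite big_nil; exact: cvg_cst.
rewrite big_cons; under eq_fun do rewrite big_cons; apply: cvgD => //; exact: ul.
Qed.

(** * Monotone convergence for finitely supported rows that increase to a series *)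

Section DoubleSum.
Variables (a : nat -> nat -> R) (b : nat -> R) (d : nat -> nat).
Hypothesis a_ge0 : forall N k, 0 <= a N k.
Hypothesis a_le : forall N k, a N k <= a N.+1 k.
Hypothesis a_cvg : forall k, a ^~ k @ \oo --> b k.
Hypothesis a_supp : forall N k, (d N <= k)%N -> a N k = 0.

Let s N := \sum_(k < d N) a N k.

Let sE N M : (d N <= M)%N -> s N = \sum_(k < M) a N k.
Proof.
move=> dM; rewrite /s -!(big_mkord xpredT) (big_cat_nat (leq0n _) dM) /=.
rewrite [X in _ = _ + X]big_nat_cond [X in _ = _ + X]big1 ?addr0// => k.
by rewrite andbT => /andP[dk _]; exact: a_supp.
Qed.

Let s_le N : s N <= s N.+1.
Proof.
rewrite (sE (leq_maxl (d N) (d N.+1))) (sE (leq_maxr (d N) (d N.+1))).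
exact: ler_sum.
Qed.

Let partial_le N K : \sum_(k < K) a N k <= s N.
Proof.
rewrite (sE (leq_maxl (d N) K)) -!(big_mkord xpredT).
by rewrite (big_cat_nat (leq0n _) (leq_maxr (d N) K)) /= lerDl sumr_ge0.
Qed.

Let b_ge0 k : 0 <= b k.
Proof. by apply: (cvg_ge_cst (@a_cvg k)) => N. Qed.

Let ab N k : a N k <= b k.
Proof. exact: (nondecreasing_seq_le_lim (fun n => a_le n k) (@a_cvg k)). Qed.

Let sb_le K : \sum_(k < K) b k <= \sum_(k < K.+1) b k.
Proof. by rewrite big_ord_recr /= lerDl. Qed.

(** For fixed K the finite sum of the limits is the limit of finite sums, each below a full row
    sum. *)
Let sb_upper L : (forall N, s N <= L) -> forall K, \sum_(k < K) b k <= L.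
Proof.
move=> sL K; have h : (fun N => \sum_(k < K) a N k) @ \oo --> \sum_(k < K) b k.
  by apply: (cvg_sum_seq _ (u := fun k : 'I_K => a ^~ k)).
by apply: (cvg_le_cst h) => N; exact: le_trans (partial_le N K) (sL N).
Qed.

Lemma monotone_sum_cvg (L : R) :
  (fun K => \sum_(k < K) b k) @ \oo --> L -> (fun N => \sum_(k < d N) a N k) @ \oo --> L.
Proof.
move=> bL; have sL N : s N <= L.
  apply: le_trans (nondecreasing_seq_le_lim sb_le bL (d N)).
  exact: ler_sum.
have [l sl lL] := nondecreasing_bounded_cvg s_le sL.
suff -> : L = l by [].
apply: le_anti; rewrite lL andbT; apply: (cvg_le_cst bL).
by apply: sb_upper; exact: nondecreasing_seq_le_lim.
Qed.

(** Here convergence of the series is a conclusion: its partial sums increase and [sb_upper] bounds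
    them by the limit of the row sums. *)
Lemma monotone_sum_series (L : R) :
  (fun N => \sum_(k < d N) a N k) @ \oo --> L -> (fun K => \sum_(k < K) b k) @ \oo --> L.
Proof.
move=> sL; have [l bl _] := nondecreasing_bounded_cvg sb_le
  (sb_upper (nondecreasing_seq_le_lim s_le sL)).
by rewrite (cvg_unique _ sL (monotone_sum_cvg bl)).
Qed.

End DoubleSum.

Definition approximates (p : nat -> {poly R}) (g : nat -> R) : Prop :=
  [/\ forall N k, 0 <= (p N)`_k, forall N k, (p N)`_k <= (p N.+1)`_k
    & forall k, (fun N => (p N)`_k) @ \oo --> g k].

Lemma approximates_ge0 p g k : approximates p g -> 0 <= g k.
Proof. by case=> p0 _ pg; apply: (cvg_ge_cst (pg k)) => N. Qed.

Lemma approximates_le p g N k : approximates p g -> (p N)`_k <= g k.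
Proof.
by case=> _ ple pg; exact: (nondecreasing_seq_le_lim (fun n => ple n k) (pg k)).
Qed.

(** At x >= 0 the terms inherit monotonicity from the coefficients. The lemma passes from the series
    to the values of the polynomials, and [approximates_series] passes back. *)
Lemma approximates_horner p g (x L : R) : approximates p g -> 0 <= x ->
  (fun K => \sum_(k < K) g k * x ^+ k) @ \oo --> L -> (fun N => (p N).[x]) @ \oo --> L.
Proof.
move=> [p0 ple pg] x0 gL; under eq_fun do rewrite horner_coef.
apply: (@monotone_sum_cvg (fun N k => (p N)`_k * x ^+ k) (fun k => g k * x ^+ k)) => //.
- by move=> N k; rewrite mulr_ge0// exprn_ge0.
- by move=> N k; rewrite ler_wpM2r// exprn_ge0.
- by move=> k; apply: cvgMl.
- by move=> N k /leq_sizeP/(_ k (leqnn k)) ->; rewrite mul0r.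
Qed.

Lemma approximates_series p g (x L : R) : approximates p g -> 0 <= x ->
  (fun N => (p N).[x]) @ \oo --> L -> (fun K => \sum_(k < K) g k * x ^+ k) @ \oo --> L.
Proof.
move=> [p0 ple pg] x0; under eq_fun do rewrite horner_coef.
apply: (@monotone_sum_series (fun N k => (p N)`_k * x ^+ k) (fun k => g k * x ^+ k)) => //.
- by move=> N k; rewrite mulr_ge0// exprn_ge0.
- by move=> N k; rewrite ler_wpM2r// exprn_ge0.
- by move=> k; apply: cvgMl.
- by move=> N k /leq_sizeP/(_ k (leqnn k)) ->; rewrite mul0r.
Qed.

End MonotoneApproximation.

(** * The operator on coefficient sequences and phi(Delta) for polynomial phi *)

Section DeltaOfPolynomials.
Variables (R : realType) (theta omega : R).

(** Read off from Delta z^n = n (theta + n - 1) z^(n-1) + omega n z^n. For theta, omega >= 0 the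
    weights are nonnegative, which makes the operator monotone. *)
Definition seqDelta (f : nat -> R) : nat -> R :=
  fun n => n.+1%:R * (theta + n%:R) * f n.+1 + omega * n%:R * f n.

Lemma coef_polyDelta p n : (polyDelta theta omega p)`_n = seqDelta (nth 0 p) n.
Proof.
rewrite /polyDelta /seqDelta mulrDl -scalerAl -mulrA !coefD coefCM coefZ !coefXM.
rewrite !coef_deriv; case: n => [|n] /=; first by rewrite !mulr0 mul0r !addr0 mulr1n mul1r.
by ring.
Qed.

Lemma coef_iter_polyDelta k p n :
  (iter k (polyDelta theta omega) p)`_n = iter k seqDelta (nth 0 p) n.
Proof.
elim: k n => [//|k IH] n; rewrite !iterS coef_polyDelta /seqDelta.
by rewrite !IH.
Qed.

Definition polyOp (phi p : {poly R}) : {poly R} :=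
  \sum_(k < size phi) phi`_k *: iter k (polyDelta theta omega) p.

Lemma polyOp_widen n (phi p : {poly R}) : (size phi <= n)%N ->
  polyOp phi p = \sum_(k < n) phi`_k *: iter k (polyDelta theta omega) p.
Proof.
move=> le; rewrite /polyOp -!(big_mkord xpredT (fun k => phi`_k *: iter k _ p)).
rewrite (big_cat_nat (leq0n _) le) /=.
rewrite [X in _ = _ + X]big_nat_cond [X in _ = _ + X]big1 ?addr0// => k.
by rewrite andbT => /andP[/leq_sizeP/(_ k (leqnn k)) -> _]; rewrite scale0r.
Qed.

Lemma polyDeltaD p q :
  polyDelta theta omega (p + q) = polyDelta theta omega p + polyDelta theta omega q.
Proof. by rewrite /polyDelta !derivD !mulrDr addrACA. Qed.

Lemma polyDelta_sum I (r : seq I) (F : I -> {poly R}) :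
  polyDelta theta omega (\sum_(i <- r) F i) = \sum_(i <- r) polyDelta theta omega (F i).
Proof.
apply: (big_morph _ polyDeltaD).
by rewrite /polyDelta !deriv0 !mulr0 addr0.
Qed.

Lemma polyOpZ c (phi p : {poly R}) : polyOp (c *: phi) p = c *: polyOp phi p.
Proof.
rewrite (polyOp_widen _ (size_scale_leq c phi)) scaler_sumr.
by apply: eq_bigr => k _; rewrite coefZ scalerA.
Qed.

(** A factor X + r of phi becomes the operator r + Delta, so that phi(Delta) can be applied one root
    at a time. *)
Lemma polyOp_XDC r (phi p : {poly R}) :
  polyOp (phi * ('X + r%:P)) p = r *: polyOp phi p + polyDelta theta omega (polyOp phi p).
Proof.
(* A common length for all sums; the successor leaves room for the shift in X phi. *)
pose n := maxn (size phi).+1 (size (phi * ('X + r%:P))).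
have -> : polyDelta theta omega (polyOp phi p) =
    \sum_(k < n) ('X * phi)`_k *: iter k (polyDelta theta omega) p.
  transitivity (\sum_(k < (size phi).+1) ('X * phi)`_k *: iter k (polyDelta theta omega) p).
    rewrite /polyOp polyDelta_sum big_ord_recl coefXM /= scale0r add0r.
    by apply: eq_bigr => k _; rewrite coefXM polyDeltaZ.
  rewrite -!(big_mkord xpredT (fun k => ('X * phi)`_k *: iter k _ p)).
  rewrite [RHS](big_cat_nat (leq0n _) (leq_maxl _ _)) /=.
  rewrite [X in _ = _ + X]big_nat_cond [X in _ = _ + X]big1 ?addr0// => k.
  by rewrite andbT coefXM => /andP[]; case: k => //= k /leq_sizeP -> //; rewrite scale0r.
rewrite (polyOp_widen _ (leq_maxr (size phi).+1 _)) -/n.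
rewrite (@polyOp_widen n phi); last exact: leq_trans (leqnSn _) (leq_maxl _ _).
rewrite scaler_sumr -big_split; apply: eq_bigr => k _ /=.
by rewrite mulrDr coefD coefMC scalerDl scalerA addrC [r * _]mulrC ['X * _]mulrC.
Qed.

Hypotheses (theta_ge0 : 0 <= theta) (omega_ge0 : 0 <= omega).

Lemma nonpos_rooted_polyOp phi p :
  nonpos_rooted phi -> nonpos_rooted p -> nonpos_rooted (polyOp phi p).
Proof.
move=> [c [rs [hrs ->]]] hp; rewrite polyOpZ; apply: nonpos_rootedZ.
elim: rs hrs => [|r rs IH] /=.
  by rewrite big_nil /polyOp size_poly1 big_ord1 coef1 scale1r.
move=> /andP[r0 hrs]; rewrite big_cons mulrC polyOp_XDC -[polyDelta _ _ _]scale1r.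
by apply: nonpos_rooted_polyDelta => //; exact: IH.
Qed.

Lemma seqDelta_ge0 f : (forall n, 0 <= f n) -> forall n, 0 <= seqDelta f n.
Proof. by move=> f0 n; rewrite /seqDelta addr_ge0// !mulr_ge0// addr_ge0. Qed.

Lemma seqDelta_le f g : (forall n, f n <= g n) -> forall n, seqDelta f n <= seqDelta g n.
Proof.
by move=> fg n; rewrite /seqDelta lerD// ler_wpM2l// !mulr_ge0// addr_ge0.
Qed.

Lemma iter_seqDelta_ge0 k f : (forall n, 0 <= f n) -> forall n, 0 <= iter k seqDelta f n.
Proof. by move=> f0; elim: k => [|k IH] //; exact: seqDelta_ge0. Qed.

Lemma iter_seqDelta_le k f g : (forall n, f n <= g n) ->
  forall n, iter k seqDelta f n <= iter k seqDelta g n.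
Proof. by move=> fg; elim: k => [|k IH] //; exact: seqDelta_le. Qed.

Lemma iter_seqDelta_cvg k (u : nat -> nat -> R) (f : nat -> R) :
  (forall n, u ^~ n @ \oo --> f n) ->
  forall n, (fun N => iter k seqDelta (u N) n) @ \oo --> iter k seqDelta f n.
Proof.
move=> uf; elim: k => [|k IH] n; first exact: uf.
by rewrite iterS /seqDelta; apply: cvgD; apply: cvgMr; exact: IH.
Qed.

Lemma coef_polyOp phi p n :
  (polyOp phi p)`_n = \sum_(k < size phi) phi`_k * iter k seqDelta (nth 0 p) n.
Proof.
rewrite /polyOp coef_sum; apply: eq_bigr => k _.
by rewrite coefZ coef_iter_polyDelta.
Qed.

Lemma approximates_polyOp (P Q : nat -> {poly R}) (phi f g : nat -> R) :
  approximates P phi -> approximates Q f ->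
  (forall n, (fun K => \sum_(k < K) phi k * iter k seqDelta f n) @ \oo --> g n) ->
  approximates (fun N => polyOp (P N) (Q N)) g.
Proof.
move=> [P0 Ple Pphi] [Q0 Qle Qf] hg.
pose a n N k := (P N)`_k * iter k seqDelta (nth 0 (Q N)) n.
have a0 n N k : 0 <= a n N k by rewrite mulr_ge0// iter_seqDelta_ge0.
have ale n N k : a n N k <= a n N.+1 k.
  by rewrite ler_pM// ?iter_seqDelta_ge0//; exact: iter_seqDelta_le.
have asupp n N k : (size (P N) <= k)%N -> a n N k = 0.
  by move=> /leq_sizeP/(_ k (leqnn k)) PN; rewrite /a PN mul0r.
split=> [N k|N k|n].
- by rewrite coef_polyOp; apply: sumr_ge0 => i _; exact: a0.
(* Both sums are extended to the larger of the two sizes: the left one only grows, the right one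
   only gains zero terms. *)
- rewrite !coef_polyOp; set d := size (P N); set e := size _.
  apply: (@le_trans _ _ (\sum_(i < maxn d e) a k N i)).
    rewrite -!(big_mkord xpredT (a k N)).
    by rewrite [leRHS](big_cat_nat (leq0n _) (leq_maxl d e)) /= lerDl sumr_ge0.
  apply: (@le_trans _ _ (\sum_(i < maxn d e) a k N.+1 i)); first exact: ler_sum.
  rewrite -!(big_mkord xpredT (a k N.+1)).
  rewrite [leLHS](big_cat_nat (leq0n _) (leq_maxr d e)) /= gerDl.
  rewrite big_nat_cond big1// => i /andP[/andP[ei _] _]; exact: asupp.
- under eq_fun do rewrite coef_polyOp.
  apply: (@monotone_sum_cvg _ (a n) (fun k => phi k * iter k seqDelta f n)) => //; last first.
    by move=> N k; exact: asupp.
  by move=> k; apply: cvgM => //; exact: iter_seqDelta_cvg.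
Qed.

End DeltaOfPolynomials.

(** * The growth estimate *)

Section GrowthEstimate.
Variable R : realType.
Variables (theta omega : R).
Hypotheses (theta_ge0 : 0 <= theta) (omega_ge0 : 0 <= omega).

Definition expcoef (b : R) (n : nat) : R := b ^+ n / n`!%:R.

Lemma expcoef_ge0 b n : 0 <= b -> 0 <= expcoef b n.
Proof. by move=> b0; rewrite divr_ge0// exprn_ge0. Qed.

Lemma expcoefS b n : n.+1%:R * expcoef b n.+1 = b * expcoef b n.
Proof.
have x0 : n.+1%:R != 0 :> R by rewrite pnatr_eq0.
by rewrite /expcoef factS natrM invfM exprS mulrCA mulVKf// mulrA.
Qed.

Lemma qfun0 : qfun omega 0 = 0 :> R.
Proof. by rewrite /qfun; case: ifP => // _; rewrite mul0r expR0 subrr mul0r. Qed.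

Lemma is_derive_qfun_neq0 (w0 : omega != 0) (t : R) :
  is_derive t 1 (fun a => (expR (a * omega) - 1) / omega) (expR (t * omega)).
Proof.
have -> : (fun a : R => (expR (a * omega) - 1) / omega) =
    omega^-1 *: ((expR \o (omega *: (id : R -> R))) - cst 1).
  by apply/funext => x /=; rewrite !fctE /= /GRing.scale /= mulrC [x * _]mulrC.
apply: is_derive_eq.
by rewrite !fctE /GRing.scale /= [omega * t]mulrC; field; exact: w0.
Qed.

(** The derivative of D^(-k) for a real exponent k, written exp(-k ln D). It serves with k = theta
    and, for the inverse of D, with k = 1. *)
Lemma is_derive_expR_ln k (D : R -> R) (t d' : R) : 0 < D t -> is_derive t 1 D d' ->
  is_derive t 1 (fun x => expR (- k * ln (D x)))
    (expR (- k * ln (D t)) * (- k * (d' / D t))).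
Proof.
move=> D0 hD; have hl : is_derive t 1 (@ln R \o D) (d' / D t).
  by have ? := is_derive1_ln D0; apply: is_derive_eq; rewrite mulrC.
have -> : (fun x : R => expR (- k * ln (D x))) = @expR R \o ((- k) *: (@ln R \o D)).
  by apply/funext.
by apply: is_derive_eq; rewrite /GRing.scale.
Qed.

(** At n = 0 the truncated predecessor does no harm, because the factor n annihilates its term. *)
Lemma is_deriveM_expcoef (A c : R -> R) (t A' c' : R) n :
  is_derive t 1 A A' -> is_derive t 1 c c' ->
  is_derive t 1 (fun x => A x * expcoef (c x) n)
    (A' * expcoef (c t) n + A t * (c' * (n%:R * c t ^+ n.-1 / n`!%:R))).
Proof.
move=> hA hc.
have -> : (fun x => A x * expcoef (c x) n) = (n`!%:R^-1 : R) *: (A * c ^+ n).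
  by apply/funext => x; rewrite /expcoef !fctE /GRing.scale /=; ring.
case: n => [|n].
  rewrite expr0; apply: is_derive_eq.
  by rewrite /expcoef /GRing.scale /= expr0 (_ : (1 : R -> R) t = 1)//; ring.
by apply: is_derive_eq; rewrite /expcoef !fctE /GRing.scale /=; ring.
Qed.

(** Differentiation lowers t^k/k! to the preceding term and kills the constant one, so a truncated
    exponential series loses one term. This is why the comparison below is an induction on the
    truncation. *)
Lemma is_derive_exp_sum (w : nat -> R) N (t : R) :
  is_derive t 1 (fun t => \sum_(k < N.+1) expcoef t k * w k)
    (\sum_(k < N) expcoef t k * w k.+1).
Proof.
have -> : (fun t => \sum_(k < N.+1) expcoef t k * w k) =
    \sum_(k < N.+1) (w k / k`!%:R) *: (id : R -> R) ^+ k.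
  apply/funext => x; rewrite fct_sumE; apply: eq_bigr => k _.
  by rewrite /expcoef !fctE /GRing.scale /=; ring.
have hk (k : 'I_N.+1) : is_derive t 1 ((w k / k`!%:R) *: (id : R -> R) ^+ k)
    (if k : nat is k'.+1 then expcoef t k' * w k'.+1 else 0).
  case: k => [[|k] hk] /=; first by rewrite expr0; apply: is_derive_eq; rewrite scaler0.
  apply: is_derive_eq; rewrite /GRing.scale /= /expcoef factS natrM; field.
  by rewrite [1 + _]addrC natr1 !pnatr_eq0 -lt0n fact_gt0.
by apply: is_derive_eq; rewrite big_ord_recl /= add0r.
Qed.

Lemma is_derive_qfun (t : R) : is_derive t 1 (qfun omega) (expR (t * omega)).
Proof.
rewrite /qfun; have [->|w0] := eqVneq omega 0.
  by rewrite mulr0 expR0; exact: is_derive_id.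
exact: is_derive_qfun_neq0.
Qed.

Lemma qfun_le (s t : R) : s <= t -> qfun omega s <= qfun omega t.
Proof.
rewrite /qfun; case: ifP => // w0 st.
by rewrite ler_pM2r ?invr_gt0 ?lt_def ?w0// lerB// ler_expR ler_wpM2r.
Qed.

Section Comparison.
Variables (a b : R).
Hypotheses (a_ge0 : 0 <= a) (b_ge0 : 0 <= b) (abq : b * qfun omega a < 1).

Let D (t : R) : R := 1 - b * qfun omega t.
(* [c t] is [cconst omega t b]; the inverse of [D t] is written as an exponential
   to differentiate it with [is_derive_expR_ln]. *)
Let c (t : R) : R := b * expR (t * omega) * expR (- 1 * ln (D t)).
Let A (t : R) : R := expR (- theta * ln (D t)).
(* The coefficients of exp(t Delta) e^{bz} = D(t)^(-theta) e^{c(t) z}: as c' = omega c + c^2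
   and A' = theta c A, they solve v' = Delta v. *)
Let v (n : nat) (t : R) : R := A t * expcoef (c t) n.
Let u (N n : nat) (t : R) : R :=
  \sum_(k < N) expcoef t k * iter k (seqDelta theta omega) (expcoef b) n.

Let D_gt0 t : t <= a -> 0 < D t.
Proof.
move=> ta; rewrite subr_gt0; apply: le_lt_trans abq.
by rewrite ler_wpM2l// qfun_le.
Qed.

Let expR_lnD t : t <= a -> expR (- 1 * ln (D t)) = (D t)^-1.
Proof. by move=> ta; rewrite mulN1r expRN lnK// posrE D_gt0. Qed.

Let is_derive_D (t : R) : is_derive t 1 D (- b * expR (t * omega)).
Proof.
have -> : D = cst 1 - b *: (qfun omega) by apply/funext.
have ? := is_derive_qfun t.
by apply: is_derive_eq; rewrite /GRing.scale /= sub0r mulNr.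
Qed.

Let is_derive_c (t : R) : t <= a -> is_derive t 1 c (omega * c t + c t ^+ 2).
Proof.
move=> ta; have hE := is_derive_expR_ln 1 (D_gt0 ta) (is_derive_D t).
have -> : c = b *: ((@expR R \o (omega *: (id : R -> R))) *
    (fun x => expR (- 1 * ln (D x)))).
  by apply/funext => x; rewrite /c !fctE /GRing.scale /= [omega * x]mulrC mulrA.
apply: is_derive_eq; rewrite !fctE /GRing.scale /= [omega * t]mulrC.
rewrite /c expR_lnD//; have := D_gt0 ta; move: (D t) => d d0.
by field; rewrite gt_eqF.
Qed.

Let is_derive_A (t : R) : t <= a -> is_derive t 1 A (theta * c t * A t).
Proof.
move=> ta; have hE := is_derive_expR_ln theta (D_gt0 ta) (is_derive_D t).
apply: is_derive_eq; rewrite /c expR_lnD// -/(A t); have := D_gt0 ta.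
by move: (D t) => d d0; field; rewrite gt_eqF.
Qed.

Let is_derive_v n (t : R) : t <= a ->
  is_derive t 1 (v n) (seqDelta theta omega (fun m => v m t) n).
Proof.
move=> ta; have hA := is_derive_A ta; have hc := is_derive_c ta.
have hv := is_deriveM_expcoef n hA hc; apply: is_derive_eq.
rewrite /seqDelta /v.
(* Both sides reduce to A(t) times the n-th coefficient of e^{c(t) z} times theta c + n (omega +
   c). *)
have -> : n.+1%:R * (theta + n%:R) * (A t * expcoef (c t) n.+1) =
    (theta + n%:R) * A t * (n.+1%:R * expcoef (c t) n.+1) by ring.
rewrite expcoefS.
have -> : (omega * c t + c t ^+ 2) * (n%:R * c t ^+ n.-1 / n`!%:R) =
    (omega + c t) * (n%:R * expcoef (c t) n).
  by rewrite /expcoef; case: (n) => [|m] /=; rewrite ?mul0r ?mulr0// [c t ^+ m.+1]exprS; ring.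
ring.
Qed.

Let seqDelta_sum N (w : 'I_N -> nat -> R) (y : 'I_N -> R) n :
  seqDelta theta omega (fun m => \sum_(k < N) y k * w k m) n =
  \sum_(k < N) y k * seqDelta theta omega (w k) n.
Proof.
rewrite /seqDelta !mulr_sumr -big_split; apply: eq_bigr => k _ /=; ring.
Qed.

Let is_derive_u N n (t : R) :
  is_derive t 1 (u N.+1 n) (seqDelta theta omega (fun m => u N m t) n).
Proof.
have hu := is_derive_exp_sum (fun k => iter k (seqDelta theta omega) (expcoef b) n) N t.
by apply: is_derive_eq; rewrite /u seqDelta_sum.
Qed.

(* The partial sums satisfy u_{N+1}' = Delta u_N with the same initial value as v, and
   Delta is monotone on nonnegative sequences. *)
Let u_le_v N n (t : R) : 0 <= t <= a -> u N n t <= v n t.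
Proof.
elim: N n t => [|N IH] n t /andP[t0 ta].
  by rewrite /u big_ord0 mulr_ge0 ?expR_ge0// expcoef_ge0// !mulr_ge0// expR_ge0.
rewrite -subr_ge0; pose f := v n - u N.+1 n.
pose df x := seqDelta theta omega (fun m => v m x) n -
  seqDelta theta omega (fun m => u N m x) n.
have hf (x : R) : x <= a -> is_derive x 1 f (df x).
  by move=> xa; have ? := is_derive_v n xa; have ? := is_derive_u N n x; exact: is_deriveB.
(* At t = 0 one has D = A = 1 and c = b, and only the term k = 0 of u survives, so both functions
   equal [expcoef b n]. *)
have f0 : f 0 = 0.
  rewrite /f !fctE /v /A /c /D qfun0 mulr0 subr0 ln1 !mulr0 expR0 mul0r expR0 !mulr1 mul1r.
  rewrite /u big_ord_recl big1 ?addr0 => [|k _].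
    by rewrite /expcoef expr0 invr1 !mul1r subrr.
  by rewrite /expcoef /= exprS !mul0r.
(* The sign of f(t) is that of the derivative at an intermediate point xi. There the induction
   hypothesis is needed for every index m, hence its quantification over index and time. *)
have [x||xi xiI] := @MVT_segment _ f df 0 t t0.
- by rewrite in_itv /= => /andP[_ xt]; apply: hf; exact: le_trans (ltW xt) ta.
- apply: derivable_within_continuous => x; rewrite in_itv /= => /andP[_ xt].
  by have [] := hf x (le_trans xt ta).
rewrite f0 !subr0 => fE; rewrite -[leRHS]/(f t) fE mulr_ge0//.
move: xiI; rewrite in_itv /= => /andP[xi0 xit].
rewrite subr_ge0; apply: seqDelta_le => // m; apply: IH.
by rewrite xi0 (le_trans xit ta).
Qed.

Lemma exp_seqDelta_bound : exists2 K : R, 0 <= K &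
  forall N n, \sum_(k < N) expcoef a k * iter k (seqDelta theta omega) (expcoef b) n <=
    K * expcoef (cconst omega a b) n.
Proof.
(* K is D(a)^(-theta), the prefactor of exp(a Delta) e^{bz}. *)
exists (A a); first exact: expR_ge0.
move=> N n; rewrite /cconst -expR_lnD//; apply: u_le_v.
by rewrite a_ge0 lexx.
Qed.

End Comparison.
End GrowthEstimate.

(** * Limits of polynomials with nonpositive roots *)

Section ComplexExponential.
Variable R : realType.
Local Notation C := R[i].
Local Notation normc := (@Normc.normc R).
Implicit Types (x y d : R) (z w : C) (s : seq R).

Lemma cexpD z w : cexp (z + w) = cexp z * cexp w.
Proof.
apply/eqP; rewrite eq_complex /= ReD ImD expRD cosD sinD.
by apply/andP; split; apply/eqP; ring.
Qed.

Lemma cexp_real x : cexp x%:C = (expR x)%:C.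
Proof. by rewrite /cexp /= cos0 sin0 mulr1 mulr0. Qed.

Lemma cexp0 : cexp 0 = 1 :> C.
Proof. by rewrite (cexp_real 0) expR0. Qed.

Lemma normc_cexp z : normc (cexp z) = expR (complex.Re z).
Proof.
rewrite normcE2 /= !exprMn -mulrDr addrC sin2cos2 subrK mulr1.
by rewrite sqrtr_sqr ger0_norm ?expR_ge0.
Qed.

Lemma normc_cexp_le z : normc (cexp z) <= expR (normc z).
Proof.
rewrite normc_cexp ler_expR; apply: le_trans (Re_le_normc z).
exact: ler_norm.
Qed.

Lemma sin_mvt y : 0 <= y -> exists2 c, 0 <= c <= y & sin y = cos c * y.
Proof.
move=> y0; have [|c cI] := @MVT_segment R (@sin R) (@cos R) 0 y y0.
  by apply: continuous_subspaceT; exact: continuous_sin.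
by rewrite sin0 !subr0 => ->; exists c.
Qed.

Lemma abs_sin_le y : `|sin y| <= `|y|.
Proof.
wlog y0 : y / 0 <= y.
  move=> H; have [|y0] := leP 0 y; first exact: H.
  by rewrite -normrN -sinN -[`|y|]normrN; apply: H; rewrite oppr_ge0 ltW.
have [c _ ->] := sin_mvt y0; rewrite normrM ler_piMl// ler_norml.
by rewrite cos_geN1 cos_le1.
Qed.

Lemma one_sub_cos_le y : 0 <= 1 - cos y <= y ^+ 2.
Proof.
rewrite subr_ge0 cos_le1 /=.
have -> : 1 - cos y = 2 * sin (y / 2) ^+ 2.
  by rewrite {1}[y]splitr cosD -!expr2 cos2sin2; ring.
have : sin (y / 2) ^+ 2 <= (y / 2) ^+ 2.
  rewrite -[leLHS]real_normK ?num_real// -[leRHS]real_normK ?num_real//.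
  by rewrite ler_sqr ?nnegrE// abs_sin_le.
have := sqr_ge0 y; rewrite expr_div_n; lra.
Qed.

(** By the mean value theorem y - sin y = (1 - cos c) y with c between 0 and y, and 1 - cos c <= c^2
    <= y^2 <= y; a quadratic bound is all that is needed. *)
Lemma abs_sin_sub_le y : `|y| <= 1 -> `|y - sin y| <= y ^+ 2.
Proof.
wlog y0 : y / 0 <= y.
  move=> H; have [|y0] := leP 0 y; first exact: H.
  rewrite -normrN -[`|y - _|]normrN opprD -sinN -sqrrN.
  by apply: H; rewrite oppr_ge0 ltW.
rewrite ger0_norm// => y1; have [c /andP[c0 cy] ->] := sin_mvt y0.
have /andP[d0 d1] := one_sub_cos_le c.
rewrite -{1}[y]mul1r -mulrBl normrM !ger0_norm//.
have : (1 - cos c) * y <= 1 * y ^+ 2; last by rewrite mul1r.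
have c2 : c ^+ 2 <= y ^+ 2 by rewrite ler_sqr ?nnegrE.
have y2 : y ^+ 2 <= y by rewrite expr2 ler_piMl.
rewrite mul1r expr2 ler_wpM2r//; lra.
Qed.

Lemma expR_mul1B_le1 x : expR x * (1 - x) <= 1.
Proof.
have := expR_ge1Dx (- x); rewrite expRN => e; have ex0 := expR_gt0 x.
by apply: le_trans (ler_wpM2l (ltW ex0) e) _; rewrite mulfV ?gt_eqF.
Qed.

Lemma expR_sub1D_le x : `|x| <= 1 / 2 -> 0 <= expR x - (1 + x) <= 2 * x ^+ 2.
Proof.
move=> x12; have /andP[x1 x2] : - (1 / 2) <= x <= 1 / 2 by rewrite -ler_norml.
apply/andP; split; first by rewrite subr_ge0 expR_ge1Dx.
have h := expR_mul1B_le1 x.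
have : (expR x - (1 + x)) * (1 - x) <= x ^+ 2 by rewrite mulrBl; lra.
have : 0 <= expR x - (1 + x) by rewrite subr_ge0 expR_ge1Dx.
by move: (expR x - (1 + x)) => e e0 he; nra.
Qed.

(** With z = x + iy, the real part contributes at most 2x^2 + 2y^2 and the imaginary part at most
    x^2 + 2y^2, whence the factor 4. *)
Lemma cexp_sub1D_le z : normc z <= 1 / 2 -> normc (1 + z - cexp z) <= 4 * normc z ^+ 2.
Proof.
move=> z12; have zE : normc z ^+ 2 = complex.Re z ^+ 2 + complex.Im z ^+ 2.
  by rewrite normcE2 sqr_sqrtr// addr_ge0 ?sqr_ge0.
have x12 := le_trans (Re_le_normc z) z12; have y12 := le_trans (Im_le_normc z) z12.
apply: le_trans (normc_leD _) _; rewrite zE ReB ImB ReD ImD /= add0r.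
move: (complex.Re z) (complex.Im z) x12 y12 => x y x12 y12 {z z12 zE}.
have /andP[e1 e2] := expR_sub1D_le x12.
have /andP[c1 c2] := one_sub_cos_le y.
have s1 : `|y - sin y| <= y ^+ 2 by apply: abs_sin_sub_le; lra.
have s2 := abs_sin_le y.
have x2 : x ^+ 2 <= `|x| * (1 / 2) by rewrite -real_normK ?num_real// expr2 ler_wpM2l.
have xa := ler_norm x; have xb : - x <= `|x| by rewrite -normrN ler_norm.
have e3 : `|1 - expR x| <= 2 * `|x|.
  by rewrite ler_norml; apply/andP; split; lra.
have e4 : expR x <= 2 by lra.
have r1 : `|1 + x - expR x * cos y| <= 2 * x ^+ 2 + 2 * y ^+ 2.
  rewrite (_ : 1 + x - _ = - (expR x - (1 + x)) + expR x * (1 - cos y)); last by ring.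
  apply: le_trans (ler_normD _ _) _.
  rewrite normrN normrM (ger0_norm e1) (ger0_norm (expR_ge0 x)) (ger0_norm c1).
  by rewrite lerD// ler_pM// expR_ge0.
have r2 : `|y - expR x * sin y| <= y ^+ 2 + (x ^+ 2 + y ^+ 2).
  rewrite (_ : y - _ = (y - sin y) + (1 - expR x) * sin y); last by ring.
  apply: le_trans (ler_normD _ _) _; rewrite normrM lerD//.
  have : `|1 - expR x| * `|sin y| <= 2 * `|x| * `|y| by rewrite ler_pM.
  move=> /le_trans; apply; rewrite -[x ^+ 2]real_normK ?num_real// -[y ^+ 2]real_normK ?num_real//.
  by have := sqr_ge0 (`|x| - `|y|); lra.
have := sqr_ge0 x; have := sqr_ge0 y; lra.
Qed.

Lemma normc_1D_le w : normc (1 + w) <= expR (normc w).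
Proof.
by apply: le_trans (le_normcD _ _) _; rewrite Normc.normc1 expR_ge1Dx.
Qed.

Lemma normcZ_real x z : 0 <= x -> normc (x%:C * z) = x * normc z.
Proof. by move=> x0; rewrite Normc.normcM normc_real ger0_norm. Qed.

Lemma normc_prod_1D_le s z : all (fun x => 0 <= x) s ->
  normc (\prod_(x <- s) (1 + x%:C * z)) <= expR ((\sum_(x <- s) x) * normc z).
Proof.
elim: s => [|x s IH] /=; first by rewrite !big_nil mul0r expR0 Normc.normc1.
move=> /andP[x0 hs]; rewrite !big_cons Normc.normcM mulrDl expRD.
rewrite ler_pM ?normc_ge0 ?IH//; apply: le_trans (normc_1D_le _) _.
by rewrite normcZ_real.
Qed.

(** Factors 1 + xz are replaced by e^{xz} one at a time. Each replacement costs 4 |xz|^2 <= 4 |z|^2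
    d x, and the remaining factors are bounded by exponentials; the costs add up to d times the sum
    of the x. *)
Lemma prod_1D_cexp_estimate s z d : all (fun x => 0 <= x <= d) s ->
  d * normc z <= 1 / 2 ->
  normc (\prod_(x <- s) (1 + x%:C * z) - cexp ((\sum_(x <- s) x)%:C * z)) <=
  expR ((\sum_(x <- s) x) * normc z) * (4 * normc z ^+ 2 * d * \sum_(x <- s) x).
Proof.
move=> + dz; elim: s => [|x s IH] /=.
  by rewrite !big_nil mul0r cexp0 subrr Normc.normc0 !mulr0.
move=> /andP[/andP[x0 xd] hs]; rewrite !big_cons.
have s0 : all (fun y => 0 <= y) s by apply: sub_all hs => y /andP[].
have S0 : 0 <= \sum_(y <- s) y by rewrite big_seq sumr_ge0// => y /(allP s0).
move: (IH hs); set P := \prod_(y <- s) _; set S := \sum_(y <- s) y => {}IH.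
rewrite rmorphD /= !mulrDl cexpD expRD.
rewrite (_ : _ - _ = (1 + x%:C * z) * (P - cexp (S%:C * z)) +
  cexp (S%:C * z) * (1 + x%:C * z - cexp (x%:C * z))); last first.
  by move: (x%:C * z) (cexp _) (cexp _) P {IH} => a b c e; ring.
apply: le_trans (le_normcD _ _) _; rewrite !Normc.normcM.
have n0 := normc_ge0 z.
have h1 : normc (1 + x%:C * z) <= expR (x * normc z).
  by apply: le_trans (normc_1D_le _) _; rewrite normcZ_real.
have h2 : normc (cexp (S%:C * z)) <= expR (S * normc z).
  by apply: le_trans (normc_cexp_le _) _; rewrite normcZ_real.
have h3 : normc (1 + x%:C * z - cexp (x%:C * z)) <= 4 * (x * normc z) ^+ 2.
  rewrite -(normcZ_real z x0); apply: cexp_sub1D_le.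
  by rewrite normcZ_real//; apply: le_trans dz; rewrite ler_wpM2r.
have e1 : 1 <= expR (x * normc z) by rewrite -expR0 ler_expR mulr_ge0.
have eS := expR_gt0 (S * normc z).
have b1 : normc (1 + x%:C * z) * normc (P - cexp (S%:C * z)) <=
    expR (x * normc z) * (expR (S * normc z) * (4 * normc z ^+ 2 * d * S)).
  by rewrite ler_pM// normc_ge0.
have b2 : normc (cexp (S%:C * z)) * normc (1 + x%:C * z - cexp (x%:C * z)) <=
    expR (x * normc z) * (expR (S * normc z) * (4 * normc z ^+ 2 * d * x)).
  apply: (@le_trans _ _ (expR (S * normc z) * (4 * normc z ^+ 2 * d * x))).
    rewrite ler_pM ?normc_ge0//; apply: le_trans h3 _.
    rewrite (_ : 4 * (x * normc z) ^+ 2 = 4 * normc z ^+ 2 * (x * x)); last by ring.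
    by rewrite -[leRHS]mulrA ler_wpM2l ?mulr_ge0 ?sqr_ge0// ler_wpM2r.
  by rewrite ler_peMl// !mulr_ge0 ?sqr_ge0 ?(ltW eS)//; exact: le_trans x0 xd.
apply: le_trans (lerD b1 b2) _.
by rewrite le_eqVlt; apply/orP; left; apply/eqP; ring.
Qed.

End ComplexExponential.

Section ClosureOfRealRooted.
Variable R : realType.
Local Notation C := R[i].
Local Notation normc := (@Normc.normc R).

(** An ultrafilter converges to each of its cluster points, and compactness supplies one. A single
    ultrafilter serves all indices j of the roots, which replaces a diagonal extraction. *)
Lemma ultra_bounded_cvg T (F : set_system T) (u : T -> R) (B : R) : UltraFilter F ->
  (forall n, 0 <= u n <= B) -> exists l : R, u @ F --> l.
Proof.
move=> FU uB.
have [|l [_ lcl]] := @segment_compact R 0 B (u @ F) _.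
  by apply: nearW => n /=; rewrite in_itv /= uB.
exists l => V lV; have [//|FnV] := in_ultra_setVsetC (u @^-1` V) FU.
by have [x [nVx Vx]] := lcl (~` V) V FnV lV.
Qed.

Lemma sorted_ge_nth (s : seq R) i j : all (fun x => 0 <= x) s -> sorted >=%R s ->
  (i <= j)%N -> nth 0 s j <= nth 0 s i.
Proof.
move=> s0 ss ij; have [js|sj] := ltnP j (size s).
  apply: (sorted_leq_nth ge_trans ge_refl 0 ss) => //.
  by rewrite inE; exact: leq_ltn_trans js.
rewrite (nth_default _ sj); have [si|si] := ltnP i (size s).
  exact: (allP s0 _ (mem_nth _ si)).
by rewrite nth_default.
Qed.

Lemma nth_ge0 (s : seq R) i : all (fun x => 0 <= x) s -> 0 <= nth 0 s i.
Proof.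
move=> s0; have [si|si] := ltnP i (size s); last by rewrite nth_default.
exact: (allP s0 _ (mem_nth _ si)).
Qed.

(** Since f 0 is neutral, the default value 0 of [nth] pads short sequences, and J may exceed the
    length. *)
Lemma big_take_drop (T : Type) (idx : T) (op : Monoid.law idx) (f : R -> T) (s : seq R) J :
  f 0 = idx -> \big[op/idx]_(x <- s) f x =
  op (\big[op/idx]_(j < J) f (nth 0 s j)) (\big[op/idx]_(x <- drop J s) f x).
Proof.
move=> f0; elim: J s => [|J IH] s; first by rewrite drop0 big_ord0 Monoid.mul1m.
case: s => [|x s].
  by rewrite /= !big_nil big1 ?Monoid.mul1m// => j _; rewrite nth_nil.
by rewrite big_cons big_ord_recl /= IH Monoid.mulmA.
Qed.

Lemma sum_nth_le (s : seq R) J : all (fun x => 0 <= x) s ->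
  \sum_(j < J) nth 0 s j <= \sum_(x <- s) x.
Proof.
move=> s0; rewrite [leRHS](@big_take_drop _ _ _ id s J)// lerDl big_seq.
by apply: sumr_ge0 => x /mem_drop /(allP s0).
Qed.

(** Each of the first J + 1 entries is at least the J-th. This makes the tail entries uniformly
    small once the sum is bounded. *)
Lemma nth_le_sum (s : seq R) J : all (fun x => 0 <= x) s -> sorted >=%R s ->
  J.+1%:R * nth 0 s J <= \sum_(x <- s) x.
Proof.
move=> s0 ss; apply: le_trans (sum_nth_le J.+1 s0).
rewrite mulr_natl -{1}[J.+1]card_ord -sumr_const; apply: ler_sum => j _.
by apply: sorted_ge_nth => //; rewrite -ltnS.
Qed.

(** A zero root goes into X^m, and X + r with r > 0 is r (1 + X/r): the list s holds the
    reciprocals, sorted so that its j-th entry is the j-th largest. *)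
Lemma nonpos_rooted_normal_form (q : {poly R}) : nonpos_rooted q ->
  exists c m (s : seq R), [/\ all (fun x => 0 <= x) s, sorted >=%R s &
    q = c *: ('X^m * \prod_(x <- s) (1 + x *: 'X))].
Proof.
move=> [d [rs [rs0 ->]]].
suff [c [m [s [s0 E]]]] : exists c m (s : seq R), all (fun x => 0 <= x) s /\
    \prod_(r <- rs) ('X + r%:P) = c *: ('X^m * \prod_(x <- s) (1 + x *: 'X)).
  exists (d * c), m, (sort >=%R s); split.
  - by rewrite all_sort.
  - exact: (sort_sorted ge_total).
  - rewrite E scalerA; congr (_ *: (_ * _)); apply: perm_big.
    by rewrite perm_sym perm_sort.
elim: rs rs0 => [_|r rs IH /= /andP[]].
  by exists 1, 0, [::]; rewrite !big_nil expr0 mulr1 scale1r.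
rewrite le_eqVlt => /predU1P[<-|r0] /IH [c [m [s [s0 E]]]].
  by exists c, m.+1, s; split => //; rewrite big_cons E polyC0 addr0 exprS -scalerAr mulrA.
exists (c * r), m, (r^-1 :: s); split; first by rewrite /= invr_ge0 ltW.
rewrite !big_cons E.
rewrite (_ : 'X + r%:P = r *: (1 + r^-1 *: 'X)); last first.
  by rewrite scalerDr scalerA divff ?gt_eqF// scale1r -mul_polyC mulr1 addrC.
by rewrite -scalerAl -scalerAr scalerA [r * c]mulrC mulrCA.
Qed.

Lemma coef0_prod_1DZX (s : seq R) : (\prod_(x <- s) (1 + x *: 'X))`_0 = 1.
Proof.
elim: s => [|x s IH]; first by rewrite big_nil coef1.
by rewrite big_cons mulrDl mul1r coefD IH -scalerAl coefZ coefXM /= mulr0 addr0.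
Qed.

Lemma coef1_prod_1DZX (s : seq R) :
  (\prod_(x <- s) (1 + x *: 'X))`_1 = \sum_(x <- s) x.
Proof.
elim: s => [|x s IH]; first by rewrite !big_nil coef1.
by rewrite !big_cons mulrDl mul1r coefD IH -scalerAl coefZ coefXM /= coef0_prod_1DZX mulr1 addrC.
Qed.

(** The ratio of the two lowest coefficients is the sum of the reciprocals, which is how control of
    coefficients becomes control of roots. *)
Lemma nonpos_rooted_lowest (q : {poly R}) m : nonpos_rooted q -> q`_m != 0 ->
  (forall k, (k < m)%N -> q`_k = 0) ->
  exists s : seq R, [/\ all (fun x => 0 <= x) s, sorted >=%R s,
    q = q`_m *: ('X^m * \prod_(x <- s) (1 + x *: 'X)) &
    q`_m.+1 = q`_m * \sum_(x <- s) x].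
Proof.
move=> /nonpos_rooted_normal_form [c [l [s [s0 ss qE]]]] qm qlt.
have lq : q`_l = c by rewrite qE coefZ coefXnM ltnn subnn coef0_prod_1DZX mulr1.
have lm : l = m.
  case: (ltngtP l m) => // [lm|ml].
    by move: qm; rewrite qE -lq qlt// scale0r coef0 eqxx.
  by move: qm; rewrite qE coefZ coefXnM ml mulr0 eqxx.
subst l; exists s; split => //; first by rewrite lq.
by rewrite lq qE coefZ coefXnM ltnNge leqnSn /= subSnn coef1_prod_1DZX.
Qed.

Lemma abs_series_cvgC (w : nat -> C) (a : nat -> R) (L : R) :
  (forall k, normc (w k) <= a k) -> (fun n => \sum_(k < n) a k) @ \oo --> L ->
  exists2 l, cvgC (fun n => \sum_(k < n) w k) l & normc l <= L.
Proof.
move=> wa aL.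
have ca : cvgn (series a).
  by apply/cvg_ex; exists L; move: aL; under eq_fun do rewrite -(big_mkord xpredT a).
have real_case (v : nat -> R) : (forall k, `|v k| <= a k) ->
    exists l : R, (fun n => \sum_(k < n) v k) @ \oo --> l.
  move=> va; have /cvg_ex[l vl] : cvgn (series v).
    apply: normed_cvg; apply: (series_le_cvg _ _ va ca) => k //=.
    exact: le_trans (normr_ge0 _) (va k).
  by exists l; under eq_fun do rewrite -(big_mkord xpredT v).
have [k|lr hr] := real_case (fun k => complex.Re (w k)).
  exact: le_trans (Re_le_normc _) (wa k).
have [k|li hi] := real_case (fun k => complex.Im (w k)).
  exact: le_trans (Im_le_normc _) (wa k).
have wl : cvgC (fun n => \sum_(k < n) w k) (Complex lr li).
  by split; [under eq_fun do rewrite Re_sum | under eq_fun do rewrite Im_sum].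
exists (Complex lr li) => //; apply: (cvgC_normc_le wl) => n.
apply: (@le_trans _ _ (\sum_(k < n) a k)).
  by apply: le_trans (normc_sum _ _ _) _; exact: ler_sum.
apply: (@nondecreasing_seq_le_lim R (fun n => \sum_(k < n) a k)) => // k.
by rewrite big_ord_recr /= lerDl; exact: le_trans (normc_ge0 _) (wa k).
Qed.

(** The coefficients of g - p_N are nonnegative, so |G - p_N(z)| <= L - p_N(|z|), and the complex
    case follows from the real one at |z|. *)
Lemma approximates_horner_complex (p : nat -> {poly R}) g (z G : C) (L : R) :
  approximates p g ->
  (fun n => \sum_(k < n) g k * normc z ^+ k) @ \oo --> L ->
  cvgC (fun n => \sum_(k < n) (g k)%:C * z ^+ k) G ->
  cvgC (fun N => (map_poly (real_complex R) (p N)).[z]) G.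
Proof.
move=> pg gL gG; have z0 := normc_ge0 z.
have pL := approximates_horner pg z0 gL.
have g0 k : 0 <= g k := approximates_ge0 k pg.
apply: (@cvgCF_squeeze _ _ _ _ _ _ (fun N => L - (p N).[normc z])).
  apply: nearW => N; rewrite normcB.
  set q := map_poly _ _.
  (* The shift by [size (p N)] makes every partial sum cover all coefficients of p_N. *)
  have : cvgC (fun n => \sum_(k < n + size (p N)) (g k)%:C * z ^+ k - q.[z]) (G - q.[z]).
    apply: cvgCFB; last exact: cvgCF_cst.
    case: gG => gr gi; split.
      exact: (cvg_comp _ _ (cvg_addnr _) gr).
    exact: (cvg_comp _ _ (cvg_addnr _) gi).
  move=> /cvgC_normc_le; apply => n.
  set M := (n + _)%N.
  have -> : q.[z] = \sum_(k < M) ((p N)`_k)%:C * z ^+ k.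
    rewrite (@horner_coef_wide _ M) ?size_map_poly ?leq_addl//.
    by apply: eq_bigr => k _; rewrite coef_map.
  rewrite -sumrB; apply: le_trans (normc_sum _ _ _) _.
  have -> : (p N).[normc z] = \sum_(k < M) (p N)`_k * normc z ^+ k.
    by rewrite (@horner_coef_wide _ M)// leq_addl.
  rewrite lerBrDr -big_split /=.
  apply: (@le_trans _ _ (\sum_(k < M) g k * normc z ^+ k)).
    apply: ler_sum => k _; rewrite -mulrBl -rmorphB Normc.normcM normc_real normcX.
    by rewrite ger0_norm ?subr_ge0 ?(approximates_le _ _ pg)// -mulrDl subrK.
  apply: (@nondecreasing_seq_le_lim R (fun n => \sum_(k < n) g k * normc z ^+ k)) => // k.
  by rewrite big_ord_recr /= lerDl mulr_ge0// exprn_ge0.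
by rewrite -(subrr L); apply: cvgB => //; exact: cvg_cst.
Qed.


Section LimitOfRealRooted.
Variables (p : nat -> {poly R}) (g : nat -> R) (m : nat).
Hypothesis p_roots : forall N, nonpos_rooted (p N).
Hypothesis pg : approximates p g.
Hypothesis g_entire : forall x : R, 0 <= x ->
  exists L : R, (fun n => \sum_(k < n) g k * x ^+ k) @ \oo --> L.
Hypothesis pm_gt0 : forall N, 0 < (p N)`_m.
Hypothesis g_low : forall k, (k < m)%N -> g k = 0.

(** A bound on the sums of reciprocals that is uniform in N: the numerators are at most g_{m+1}, the
    denominators at least the initial coefficient of index m. *)
Let B : R := g m.+1 / (p 0)`_m.

Let g0 k : 0 <= g k.
Proof. exact: (approximates_ge0 k pg). Qed.

Let p0 N k : 0 <= (p N)`_k.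
Proof. by case: pg. Qed.

Let B0 : 0 <= B.
Proof. by rewrite divr_ge0. Qed.

Let gm_gt0 : 0 < g m.
Proof. exact: lt_le_trans (pm_gt0 0) (approximates_le 0 m pg). Qed.

Let p_low N k : (k < m)%N -> (p N)`_k = 0.
Proof.
move=> km; have := approximates_le N k pg; rewrite g_low// => pk.
by apply: le_anti; rewrite pk p0.
Qed.

Let pm_mono N : (p 0)`_m <= (p N)`_m.
Proof.
elim: N => // N IH; apply: le_trans IH _.
by case: pg => _ + _; apply.
Qed.

Let factors : exists s : nat -> seq R, forall N,
  [/\ all (fun x => 0 <= x) (s N), sorted >=%R (s N),
    p N = (p N)`_m *: ('X^m * \prod_(x <- s N) (1 + x *: 'X)) &
    (p N)`_m.+1 / (p N)`_m = \sum_(x <- s N) x].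
Proof.
suff /choice[s hs] : forall N, exists s : seq R,
  [/\ all (fun x => 0 <= x) s, sorted >=%R s,
    p N = (p N)`_m *: ('X^m * \prod_(x <- s) (1 + x *: 'X)) &
    (p N)`_m.+1 / (p N)`_m = \sum_(x <- s) x] by exists s.
move=> N.
have [||s [s0 ss pE sE]] := nonpos_rooted_lowest (p_roots N) (m := m).
- by rewrite gt_eqF.
- exact: p_low.
by exists s; split => //; rewrite sE mulrC mulKf// gt_eqF.
Qed.

(* The roots are extracted along an ultrafilter F; since the j-th largest of the numbers
   [nth 0 (s N) j] is at most B / (j + 1), the factors of index at least J contribute
   exp(z tail sum) up to O(1 / J), which produces both alpha and the infinite product. *)
Lemma limit_of_nonpos_rooted : exists (alpha : R) (beta : nat -> R) (P : C -> C),
  [/\ 0 <= alpha, forall j, 0 <= beta j.+1 <= beta j, cvgn (series beta) &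
  forall z : C, cvgC (fun n => \prod_(j < n) (1 + (beta j)%:C * z)) (P z) /\
    cvgC (fun n => \sum_(k < n) (g k)%:C * z ^+ k)
      ((g m)%:C * z ^+ m * cexp (alpha%:C * z) * P z)].
Proof.
have [s hs] := factors.
have s0 N : all (fun x => 0 <= x) (s N) by have [] := hs N.
have ss N : sorted >=%R (s N) by have [] := hs N.
have [F [FU sF]] := ultraFilterLemma (F := \oo : set_system nat) _.
pose sigma N := \sum_(x <- s N) x.
have sigmaB N : sigma N <= B.
  rewrite /sigma; have [_ _ _ <-] := hs N; apply: ler_pM.
  - exact: p0.
  - by rewrite invr_ge0 p0.
  - exact: approximates_le.
  - by rewrite lef_pV2 ?posrE.
have sigma_cvg : sigma @ F --> g m.+1 / g m.
  apply: (@cvg_trans _ (sigma @ \oo)); first by move=> A; exact: sF.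
  have -> : sigma = (fun N => (p N)`_m.+1 / (p N)`_m).
    by apply/funext => N; rewrite /sigma; have [_ _ _ ->] := hs N.
  case: pg => _ _ pgk; apply: cvgM; first exact: pgk.
  by apply: cvgV; rewrite ?gt_eqF//; exact: pgk.
have /choice[beta beta_cvg] : forall j, exists l : R, (fun N => nth 0 (s N) j) @ F --> l.
  move=> j; apply: (@ultra_bounded_cvg _ _ _ B FU) => N; rewrite nth_ge0//=.
  apply: le_trans (sigmaB N); apply: le_trans (nth_le_sum j (s0 N) (ss N)).
  by rewrite ler_peMl ?nth_ge0// ler1n.
have beta0 j : 0 <= beta j.
  by apply: (cvg_ge_cst (beta_cvg j)) => N; exact: nth_ge0.
have beta_le j : beta j.+1 <= beta j.
  rewrite -subr_ge0; apply: (@cvg_ge_cst R F _ (fun N => nth 0 (s N) j - nth 0 (s N) j.+1)).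
    by apply: cvgB; exact: beta_cvg.
  by move=> N; rewrite subr_ge0; apply: sorted_ge_nth.
have sum_cvg J : (fun N => \sum_(j < J) nth 0 (s N) j) @ F --> \sum_(j < J) beta j.
  exact: (cvg_sum_seq _ (u := fun (j : 'I_J) N => nth 0 (s N) j)).
have sum_le J : \sum_(j < J) beta j <= g m.+1 / g m.
  rewrite -subr_ge0; apply: (@cvg_ge_cst R F _ (fun N => sigma N - \sum_(j < J) nth 0 (s N) j)).
    exact: cvgB.
  by move=> N; rewrite subr_ge0; exact: sum_nth_le.
have [S sumS Sle] : exists2 S : R, (fun J => \sum_(j < J) beta j) @ \oo --> S & S <= g m.+1 / g m.
  by apply: nondecreasing_bounded_cvg => // J; rewrite big_ord_recr /= lerDl.
(* The limit of [sigma] minus what the individual limits [beta] retain: the mass carried by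
   infinitely many vanishing reciprocals. *)
pose alpha := g m.+1 / g m - S.
suff /choice[P hP] : forall z, exists P : C,
    cvgC (fun n => \prod_(j < n) (1 + (beta j)%:C * z)) P /\
    cvgC (fun n => \sum_(k < n) (g k)%:C * z ^+ k)
      ((g m)%:C * z ^+ m * cexp (alpha%:C * z) * P).
  exists alpha, beta, P; split => //.
  - by rewrite subr_ge0.
  - by move=> j; rewrite beta0 beta_le.
  - by apply/cvg_ex; exists S; move: sumS; under eq_fun do rewrite -(big_mkord xpredT beta).
(* The point 0 is separate because the main case divides by z^m. There the partial sums are constant
   from n = 1 on, the empty one being 0. *)
move=> z; have [->|z0] := eqVneq z 0.
  exists 1; split.
    have -> : (fun n => \prod_(j < n) (1 + (beta j)%:C * 0)) = fun=> 1.
      by apply/funext => n; rewrite big1// => j _; rewrite mulr0 addr0.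
    exact: cvgCF_cst.
  apply: (@cvgCF_squeeze _ _ \oo _ _ _ (fun=> 0)); last exact: cvg_cst.
  exists 1 => // -[//|n] _; rewrite big_ord_recl big1 => [|j _]; last first.
    by rewrite exprS mul0r mulr0.
  rewrite /= expr0 mulr1 addr0 mulr0 cexp0 !mulr1.
  have [->|m0] := posnP m; first by rewrite expr0 mulr1 subrr Normc.normc0.
  by rewrite g_low// expr0n gtn_eqF// mulr0 subrr Normc.normc0.
have [L gL] := g_entire (normc_ge0 z).
have [G gG _] : exists2 G, cvgC (fun n => \sum_(k < n) (g k)%:C * z ^+ k) G & normc G <= L.
  apply: (@abs_series_cvgC (fun k => (g k)%:C * z ^+ k) (fun k => g k * normc z ^+ k)) => [k|//].
  by rewrite Normc.normcM normc_real normcX ger0_norm.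
have pG := approximates_horner_complex pg gL gG.
have gz0 : (g m)%:C * z ^+ m != 0.
  by rewrite mulf_neq0 ?expf_neq0// fmorph_eq0 gt_eqF.
pose H := G / ((g m)%:C * z ^+ m).
pose h N := \prod_(x <- s N) (1 + x%:C * z).
have hH : cvgCF F h H.
  have -> : h = fun N => (map_poly (real_complex R) (p N)).[z] *
      ((p N)`_m)^-1%:C * (z ^+ m)^-1.
    apply/funext => N; have [_ _ pE _] := hs N.
    rewrite [X in map_poly _ X]pE map_polyZ rmorphM /= map_polyXn rmorph_prod /=.
    rewrite !hornerE horner_prod /h.
    have -> : \prod_(x <- s N) (map_poly (real_complex R) (1 + x *: 'X)).[z] =
        \prod_(x <- s N) (1 + x%:C * z).
      by apply: eq_bigr => x _; rewrite rmorphD /= rmorph1 map_polyZ map_polyX !hornerE.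
    rewrite rmorphV ?unitfE ?gt_eqF//=; set A := \prod_(_ <- _) _.
    have : ((p N)`_m)%:C != 0 by rewrite fmorph_eq0 gt_eqF.
    by move: (((p N)`_m)%:C) => x x0; field; rewrite x0 expf_neq0.
  have -> : H = G * (g m)^-1%:C * (z ^+ m)^-1.
    by rewrite /H rmorphV ?unitfE ?gt_eqF//= invfM mulrA.
  apply: cvgCFM; last exact: cvgCF_cst.
  apply: cvgCFM; first exact: cvgC_sub sF pG.
  apply: cvgCF_real; apply: cvgV; first by rewrite gt_eqF.
  case: pg => _ _ pgk; apply: (@cvg_trans _ ((fun N => (p N)`_m) @ \oo)); last exact: pgk.
  by move=> A; exact: sF.
pose K := expR (B * normc z) * (4 * normc z ^+ 2 * B).
pose T J := \prod_(j < J) (1 + (beta j)%:C * z) *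
  cexp ((g m.+1 / g m - \sum_(j < J) beta j)%:C * z).
(* Uniform in N: the first J factors are bounded by an exponential, the tail entries are at most B /
   (J + 1), and the two exponentials combine to at most exp(B |z|), since the reciprocals sum to at
   most B. *)
have norm_le N J : B / J.+1%:R * normc z <= 1 / 2 ->
    normc (h N - \prod_(j < J) (1 + (nth 0 (s N) j)%:C * z) *
      cexp ((sigma N - \sum_(j < J) nth 0 (s N) j)%:C * z)) <= K * (B / J.+1%:R).
  move=> dz; pose t := [seq nth 0 (s N) (val j) | j <- enum 'I_J].
  have tE (T' : Type) (idx : T') (op : Monoid.com_law idx) (f : R -> T') :
      \big[op/idx]_(j < J) f (nth 0 (s N) j) = \big[op/idx]_(x <- t) f x.
    by rewrite /t big_map big_enum.
  have t0 : all (fun x => 0 <= x) t.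
    by apply/allP => _ /mapP[j _ ->]; exact: nth_ge0.
  set r := drop J (s N).
  have r0 : all (fun x => 0 <= x <= B / J.+1%:R) r.
    apply/allP => x /(nthP 0) [i _ <-]; rewrite nth_drop nth_ge0//=.
    rewrite ler_pdivlMr ?ltr0n// mulrC; apply: le_trans (sigmaB N).
    apply: le_trans (nth_le_sum J (s0 N) (ss N)); rewrite ler_wpM2l//.
    by apply: sorted_ge_nth => //; exact: leq_addr.
  have sE : sigma N = \sum_(x <- t) x + \sum_(x <- r) x.
    by rewrite /sigma (@big_take_drop _ _ _ id _ J)// (tE _ _ _ id).
  rewrite (tE _ _ _ id) sE addrAC subrr add0r.
  rewrite /h (@big_take_drop _ _ _ (fun x => 1 + x%:C * z) _ J) ?mul0r ?addr0//.
  rewrite (tE _ _ _ (fun x => 1 + x%:C * z)) -mulrBr Normc.normcM.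
  have d0 : 0 <= B / J.+1%:R by rewrite divr_ge0.
  have r_ge0 : 0 <= \sum_(x <- r) x.
    by rewrite big_seq sumr_ge0// => x /(allP r0)/andP[].
  have t_ge0 : 0 <= \sum_(x <- t) x by rewrite big_seq sumr_ge0// => x /(allP t0).
  apply: le_trans (ler_pM (normc_ge0 _) (normc_ge0 _) (normc_prod_1D_le z t0)
    (prod_1D_cexp_estimate r0 dz)) _.
  rewrite [leLHS]mulrA -expRD -mulrDl -sE /K -[leRHS]mulrA ler_pM ?expR_ge0//.
  - by do 3!rewrite mulr_ge0 ?sqr_ge0//.
  - by rewrite ler_expR ler_wpM2r ?normc_ge0.
  rewrite [leLHS]mulrAC ler_wpM2r// ler_wpM2l ?(mulr_ge0 _ (sqr_ge0 _))//.
  by apply: le_trans (sigmaB N); rewrite sE lerDr.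
have estimate J : B / J.+1%:R * normc z <= 1 / 2 -> normc (H - T J) <= K * (B / J.+1%:R).
  move=> dz; pose TN N := \prod_(j < J) (1 + (nth 0 (s N) j)%:C * z) *
    cexp ((sigma N - \sum_(j < J) nth 0 (s N) j)%:C * z).
  have TNT : cvgCF F TN (T J).
    apply: cvgCFM.
      apply: (@cvgCF_prod R _ F _ _ _ (fun (j : 'I_J) N => 1 + (nth 0 (s N) j)%:C * z)) => j.
      apply: cvgCFD; first exact: cvgCF_cst.
      by apply: cvgCFM; [apply: cvgCF_real; exact: beta_cvg|exact: cvgCF_cst].
    apply: cvgCF_cexp; apply: cvgCFM; last exact: cvgCF_cst.
    by apply: cvgCF_real; exact: cvgB.
  have lim : (fun N => normc (h N - TN N)) @ F --> normc (H - T J).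
    by apply: cvgCF_normc; exact: cvgCFB.
  by apply: (cvg_le_cst lim) => N; exact: norm_le.
have harm : (fun J => B / J.+1%:R) @ \oo --> (0 : R).
  by rewrite -(mulr0 B); apply: cvgMr; exact: cvg_harmonic.
have TH : cvgC T H.
  apply: (@cvgCF_squeeze _ _ \oo _ _ _ (fun J => K * (B / J.+1%:R))); last first.
    by rewrite -(mulr0 K); exact: cvgMr.
  have : (fun J => B / J.+1%:R * normc z) @ \oo --> (0 : R).
    by rewrite -(mul0r (normc z)); exact: cvgMl.
  move=> /cvgr_le /(_ (1 / 2)) h2.
  by apply: filterS (h2 _) => // J; rewrite normcB; exact: estimate.
(* T n is the n-th partial product times the exponential of (sigma limit minus partial sum) z, whose
   exponent tends to alpha z; dividing by that exponential leaves the infinite product. *)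
exists (H * cexp (- alpha%:C * z)); split; last first.
  have -> : (g m)%:C * z ^+ m * cexp (alpha%:C * z) * (H * cexp (- alpha%:C * z)) = G.
    by rewrite mulrACA -cexpD mulNr addrN cexp0 mulr1 /H mulrCA mulfV// mulr1.
  exact: gG.
have -> : (fun n => \prod_(j < n) (1 + (beta j)%:C * z)) = fun n => T n *
    cexp (- (g m.+1 / g m - \sum_(j < n) beta j)%:C * z).
  by apply/funext => n; rewrite /T -mulrA -cexpD mulNr addrN cexp0 mulr1.
apply: cvgCFM => //; apply: cvgCF_cexp; apply: cvgCFM; last exact: cvgCF_cst.
by apply: cvgCFN; apply: cvgCF_real; apply: cvgB => //; exact: cvg_cst.
Qed.

End LimitOfRealRooted.

Lemma laguerre_of_approximation (p : nat -> {poly R}) (g : nat -> R) (C0 : C) :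
  (forall N, nonpos_rooted (p N)) -> approximates p g ->
  (forall x : R, 0 <= x -> exists L : R, (fun n => \sum_(k < n) g k * x ^+ k) @ \oo --> L) ->
  Laguerre (fun k => C0 * (g k)%:C).
Proof.
move=> p_roots pg g_entire; have g0 k : 0 <= g k := approximates_ge0 k pg.
have [[k gk]|gN] := pselect (exists k, g k != 0); last first.
  have gk k : g k = 0 by apply: contrapT => /eqP gk; apply: gN; exists k.
  exists 0, 0, 0, (fun=> 0); split => //; split => [j|]; first by rewrite lexx.
  split.
    apply/cvg_ex; exists 0; apply: (@cvg_trans _ ((fun=> 0 : R) @ \oo)); last exact: cvg_cst.
    by apply: near_eq_cvg; apply: nearW => n; rewrite /series /= big1.
  exists (fun=> 1) => z; split.
    have -> : (fun n => \prod_(j < n) (1 + 0%:C * z)) = fun=> 1.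
      by apply/funext => n; rewrite big1// => j _; rewrite mul0r addr0.
    exact: cvgCF_cst.
  have -> : (fun n => \sum_(k < n) C0 * (g k)%:C * z ^+ k) = fun=> 0.
    by apply/funext => n; rewrite big1// => j _; rewrite gk mulr0 mul0r.
  by rewrite !mul0r; exact: cvgCF_cst.
have ex_gk : exists k, g k != 0 by exists k.
have [m gm mmin] := ex_minnP ex_gk.
(* The first polynomials may have a zero coefficient at m; they are discarded, since
   [limit_of_nonpos_rooted] divides by this coefficient for every N. *)
have [N0 pN0] : exists N0, forall N, 0 < (p (N + N0)%N)`_m.
  case: pg => _ ple pgk; suff [N0 pN0] : exists N0, 0 < (p N0)`_m.
    by exists N0; elim=> // N IH; exact: lt_le_trans IH (ple _ _).
  apply: contrapT => pN; move/negP: gm; apply; rewrite eq_le g0 andbT.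
  apply: (cvg_le_cst (pgk m)) => N; rewrite leNgt; apply/negP => pNm.
  by apply: pN; exists N.
pose p' N := p (N + N0)%N.
have pg' : approximates p' g.
  case: pg => [h1 h2 h3]; split => [N j|N j|j]; [exact: h1|exact: h2|].
  exact: (cvg_comp _ _ (cvg_addnr _) (h3 j)).
have [||alpha [beta [P [al0 be0 cbe hP]]]] := @limit_of_nonpos_rooted p' g m _ pg' g_entire pN0.
- by move=> N; exact: p_roots.
- move=> j jm; apply/eqP; apply: contraTT jm => gj; rewrite -leqNgt; exact: mmin.
exists (C0 * (g m)%:C), m, alpha, beta; split => //; split => //; split => //.
exists P => z; have [h1 h2] := hP z; split => //.
under eq_fun do under eq_bigr do rewrite -mulrA.
under eq_fun do rewrite -mulr_sumr.
rewrite -!mulrA; apply: cvgCFM; first exact: cvgCF_cst.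
by rewrite !mulrA.
Qed.

End ClosureOfRealRooted.

(** * Polynomial approximation of Laguerre entire functions *)

Section PowerSeriesUniqueness.
Variable R : realType.
Local Notation C := R[i].
Local Notation normc := (@Normc.normc R).

(** Splitting off the head gives M + (1/2)(2M) = 2M, so the bound reproduces itself. *)
Lemma bounded_power_sum_le (d : nat -> R) (M x : R) n : 0 <= x <= 1 / 2 ->
  (forall k, `|d k| <= M) -> `|\sum_(k < n) d k * x ^+ k| <= 2 * M.
Proof.
move=> /andP[x0 x12]; elim: n d => [|n IH] d dM.
  by rewrite big_ord0 normr0 mulr_ge0// (le_trans (normr_ge0 _) (dM 0%N)).
rewrite big_ord_recl expr0 mulr1.
have -> : \sum_(i < n) d (lift ord0 i) * x ^+ lift ord0 i =
    x * \sum_(i < n) d i.+1 * x ^+ i.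
  by rewrite mulr_sumr; apply: eq_bigr => i _; rewrite exprS; ring.
apply: le_trans (ler_normD _ _) _; rewrite normrM (ger0_norm x0).
have h : x * `|\sum_(i < n) d i.+1 * x ^+ i| <= 1 / 2 * (2 * M).
  by rewrite ler_pM//; apply: (IH (fun k => d k.+1)) => k; exact: dM.
by have := dM 0%N; lra.
Qed.

Lemma cvg_succ (u : nat -> R) (l : R) :
  u @ \oo --> l -> (fun n => u n.+1) @ \oo --> l.
Proof. by move=> ul; have := ul; rewrite -cvg_shiftS. Qed.

Lemma power_series_head_eq0 (d : nat -> R) (M : R) : (forall k, `|d k| <= M) ->
  (forall x : R, 0 < x <= 1 / 2 -> (fun n => \sum_(k < n) d k * x ^+ k) @ \oo --> (0 : R)) ->
  d 0%N = 0.
Proof.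
move=> dM d0.
have M0 : 0 <= M by exact: le_trans (normr_ge0 _) (dM 0%N).
have dx (x : R) : 0 < x <= 1 / 2 -> `|d 0%N| <= x * (2 * M).
  move=> /[dup] xI /andP[x0 x12].
  have h : (fun n => `|d 0%N - \sum_(k < n.+1) d k * x ^+ k|) @ \oo --> `|d 0%N - 0|.
    apply: cvg_norm; apply: cvgB; first exact: cvg_cst.
    exact: (cvg_succ (d0 x xI)).
  rewrite -[d 0%N]subr0; apply: (cvg_le_cst h) => n.
  rewrite big_ord_recl expr0 mulr1 opprD addrA subrr sub0r normrN.
  have -> : \sum_(i < n) d (lift ord0 i) * x ^+ lift ord0 i =
      x * \sum_(i < n) d i.+1 * x ^+ i.
    by rewrite mulr_sumr; apply: eq_bigr => i _; rewrite exprS; ring.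
  rewrite normrM gtr0_norm//; apply: ler_wpM2l; first exact: ltW.
  by apply: (@bounded_power_sum_le (fun k => d k.+1)) => //; rewrite (ltW x0).
apply/eqP; apply: contraT => dN; have e0 : 0 < `|d 0%N| by rewrite normr_gt0.
have := dM 0%N => eM.
have M_gt0 : 0 < M by exact: lt_le_trans eM.
(* This x is admissible because |d_0| <= M, and it turns the estimate into |d_0| <= |d_0| / 2. *)
have := dx (`|d 0%N| / (4 * M)).
have -> : `|d 0%N| / (4 * M) * (2 * M) = `|d 0%N| / 2 by field; rewrite gt_eqF.
have -> : 0 < `|d 0%N| / (4 * M) <= 1 / 2.
  by rewrite divr_gt0 ?mulr_gt0//= ler_pdivrMr ?mulr_gt0//; lra.
by move=> /(_ isT); lra.
Qed.

Lemma power_series_eq0_bounded (d : nat -> R) (M : R) : (forall k, `|d k| <= M) ->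
  (forall x : R, 0 < x <= 1 / 2 -> (fun n => \sum_(k < n) d k * x ^+ k) @ \oo --> (0 : R)) ->
  forall k, d k = 0.
Proof.
move=> dM d0 k; elim: k d dM d0 => [|k IH] d dM d0.
  exact: (power_series_head_eq0 dM d0).
have d00 := power_series_head_eq0 dM d0.
apply: (IH (fun k => d k.+1)) => [j|x /[dup] xI /andP[x0 x12]]; first exact: dM.
have -> : (fun n => \sum_(k < n) d k.+1 * x ^+ k) =
    (fun n => x^-1 * \sum_(k < n.+1) d k * x ^+ k).
  apply/funext => n; rewrite big_ord_recl d00 mul0r add0r mulr_sumr.
  by apply: eq_bigr => i _; rewrite exprS mulrCA mulKf ?gt_eqF.
rewrite -[X in _ --> X](mulr0 x^-1); apply: cvgMr.
exact: (cvg_succ (d0 x xI)).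
Qed.

(** Convergence at x = 1 alone bounds the partial sums, and hence the coefficients as their
    differences. *)
Lemma power_series_eq0 (d : nat -> R) :
  (forall x : R, 0 <= x -> (fun n => \sum_(k < n) d k * x ^+ k) @ \oo --> (0 : R)) ->
  forall k, d k = 0.
Proof.
move=> d0; have d1 := d0 1 ler01.
have [M hM] : exists M : R, forall n, `|\sum_(k < n) d k| <= M.
  have /cvg_seq_bounded [M [_ hM]] : cvgn (fun n => \sum_(k < n) d k).
    apply/cvg_ex; exists 0; move: d1.
    by under eq_fun do under eq_bigr do rewrite expr1n mulr1.
  by exists (M + 1) => n; apply: hM => //; rewrite ltrDl.
apply: (@power_series_eq0_bounded _ (2 * M)) => [k|x /andP[x0 _]].
  have -> : d k = \sum_(j < k.+1) d j - \sum_(j < k) d j.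
    by rewrite big_ord_recr /= addrAC subrr add0r.
  apply: le_trans (ler_normB _ _) _; have := hM k.+1; have := hM k; lra.
exact/d0/ltW.
Qed.

(** Values on the nonnegative half-line already determine the coefficients, so approximation need
    only be checked where all terms have one sign. *)
Lemma power_series_unique (u v : nat -> C) (l : R -> C) :
  (forall x : R, 0 <= x -> cvgC (fun n => \sum_(k < n) u k * x%:C ^+ k) (l x)) ->
  (forall x : R, 0 <= x -> cvgC (fun n => \sum_(k < n) v k * x%:C ^+ k) (l x)) ->
  u = v.
Proof.
move=> hu hv; apply/funext => k; apply/eqP; rewrite -subr_eq0.
have d0 (x : R) : 0 <= x ->
    cvgCF \oo (fun n => \sum_(k < n) (u k - v k) * x%:C ^+ k) 0.
  move=> x0; rewrite -[X in cvgCF _ _ X](subrr (l x)).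
  have -> : (fun n => \sum_(k < n) (u k - v k) * x%:C ^+ k) = fun n =>
      \sum_(k < n) u k * x%:C ^+ k - \sum_(k < n) v k * x%:C ^+ k.
    by apply/funext => n; rewrite -sumrB; apply: eq_bigr => j _; rewrite mulrBl.
  by apply: cvgCFB; [exact: hu|exact: hv].
rewrite eq_complex; apply/andP; split; apply/eqP.
  apply: (@power_series_eq0 (fun k => complex.Re (u k - v k))) => x x0.
  have [h _] := d0 x x0; move: h; under eq_fun do rewrite Re_sum.
  by under eq_fun do under eq_bigr do rewrite -rmorphXn ReM /= mulr0 subr0.
apply: (@power_series_eq0 (fun k => complex.Im (u k - v k))) => x x0.
have [_ h] := d0 x x0; move: h; under eq_fun do rewrite Im_sum.
by under eq_fun do under eq_bigr do rewrite -rmorphXn ImM /= mulr0 add0r.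
Qed.

End PowerSeriesUniqueness.

(** * Coefficientwise increasing approximants of a Laguerre entire function *)

Section LaguerreApproximation.
Variable R : realType.
Local Notation C := R[i].
Implicit Types p q : {poly R}.

(** Nonnegativity is built in to make the relation compatible with products; [coef_le p p] expresses
    nonnegative coefficients. *)
Definition coef_le p q := forall k, 0 <= p`_k <= q`_k.

Lemma coef_leM p q p' q' : coef_le p q -> coef_le p' q' -> coef_le (p * p') (q * q').
Proof.
move=> pq pq' k; rewrite !coefM; apply/andP; split.
  apply: sumr_ge0 => i _; rewrite mulr_ge0//.
    by have /andP[] := pq i.
  by have /andP[] := pq' (k - i)%N.
apply: ler_sum => i _; have /andP[? ?] := pq i; have /andP[? ?] := pq' (k - i)%N.
exact: ler_pM.
Qed.

Lemma coef_leX p q n : coef_le p q -> coef_le (p ^+ n) (q ^+ n).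
Proof.
move=> pq; elim: n => [|n IH]; last by rewrite !exprS; exact: coef_leM.
by move=> k; rewrite !expr0 coef1 ler0n lexx.
Qed.

Lemma coef_leD p q : coef_le p p -> coef_le q q -> coef_le p (p + q).
Proof.
move=> pp qq k; have /andP[p0 _] := pp k; have /andP[q0 _] := qq k.
by rewrite p0 coefD lerDl.
Qed.

Lemma coef_le_1DZX (c : R) : 0 <= c -> coef_le (1 + c *: 'X) (1 + c *: 'X).
Proof.
by move=> c0 k; rewrite lexx coefD coefZ coef1 coefX andbT addr_ge0// mulr_ge0.
Qed.

Lemma coef_le1 : coef_le 1 1.
Proof. by move=> k; rewrite lexx coef1 ler0n. Qed.

Lemma coef_leZXn (c : R) n : 0 <= c -> coef_le (c *: 'X^n) (c *: 'X^n).
Proof. by move=> c0 k; rewrite lexx coefZ coefXn mulr_ge0. Qed.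

Lemma coef_le_Xn n : coef_le 'X^n ('X^n : {poly R}).
Proof. by move=> k; rewrite lexx coefXn ler0n. Qed.

(* Lower bound: (1 + s)^n >= e^{ns} (1 - s^2)^n >= e^{ns} (1 - n s^2) by Bernoulli. *)
Lemma expR_pow_approx (x : R) : 0 <= x ->
  (fun N => (1 + x / 2 ^+ N) ^+ (2 ^ N)) @ \oo --> expR x.
Proof.
move=> x0.
have lower : (fun N => expR x * (1 - x ^+ 2 * (1 / 2) ^+ N)) @ \oo --> expR x.
  rewrite -[X in _ --> X]mulr1; apply: cvgMr; rewrite -[X in _ --> X]subr0.
  apply: cvgB; first exact: cvg_cst.
  rewrite -(mulr0 (x ^+ 2)); apply: cvgMr; apply: cvg_expr.
  by rewrite ger0_norm; lra.
have : (fun N => x * (1 / 2) ^+ N) @ \oo --> (0 : R).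
  rewrite -(mulr0 x); apply: cvgMr; apply: cvg_expr.
  by rewrite ger0_norm; lra.
move=> /cvgr_le/(_ 1 ltr01) small.
apply: (squeeze_cvgr _ lower (cvg_cst _)); apply: filterS small => N sm.
have n0 : 0 < 2 ^+ N :> R by rewrite exprn_gt0.
have sE : x / 2 ^+ N = x * (1 / 2) ^+ N by rewrite expr_div_n expr1n mul1r.
move: sm; rewrite -sE => s1; set s := x / 2 ^+ N in s1 sE *.
have s0 : 0 <= s by rewrite divr_ge0// ltW.
have eN : expR x = expR s ^+ (2 ^ N).
  by rewrite -expRM_natl natrX /s mulrC divfK ?gt_eqF.
apply/andP; split; last first.
  by rewrite eN lerXn2r ?nnegrE ?addr_ge0 ?expR_ge0// expR_ge1Dx.
have bern n : 1 - n%:R * s ^+ 2 <= (1 - s ^+ 2) ^+ n.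
  have s2 : 0 <= 1 - s ^+ 2 by rewrite subr_ge0 expr_le1.
  elim: n => [|n IH]; first by rewrite mul0r subr0 expr0.
  rewrite [leRHS]exprS; apply: (le_trans _ (ler_wpM2l s2 IH)).
  have := ler0n R n; rewrite -natr1; have := sqr_ge0 (s ^+ 2).
  by have := sqr_ge0 s; move: (s ^+ 2) (n%:R : R) => t y *; nra.
apply: (@le_trans _ _ (expR x * (1 - s ^+ 2) ^+ (2 ^ N))).
  rewrite ler_wpM2l ?expR_ge0//; apply: (le_trans _ (bern _)).
  rewrite natrX expr_div_n expr1n mul1r lerB// /s le_eqVlt; apply/orP; left.
  by apply/eqP; field; rewrite gt_eqF.
rewrite eN -exprMn lerXn2r ?nnegrE ?addr_ge0//.
  by rewrite mulr_ge0 ?expR_ge0// subr_ge0 expr_le1.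
have h := expR_mul1B_le1 s.
rewrite (_ : expR s * _ = expR s * (1 - s) * (1 + s)); last by ring.
by rewrite -[leRHS]mul1r ler_wpM2r// addr_ge0.
Qed.


Lemma laguerre_coef_approximation (m : nat) (alpha : R) (beta : nat -> R) (Q : R -> R)
    (L := fun x => x ^+ m * expR (alpha * x) * Q x) :
  0 <= alpha -> (forall j, 0 <= beta j) ->
  (forall x : R, 0 <= x ->
    (fun n => \prod_(j < n) (1 + beta j * x)) @ \oo --> Q x) ->
  exists (p : nat -> {poly R}) (g : nat -> R),
  [/\ forall N, nonpos_rooted (p N), approximates p g &
    forall x : R, 0 <= x -> (fun n => \sum_(k < n) g k * x ^+ k) @ \oo --> L x].
Proof.
move=> alpha0 beta0 hQ.
pose q N : {poly R} := \prod_(j < N) (1 + beta j *: 'X).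
pose e N : {poly R} := (1 + (alpha / 2 ^+ N) *: 'X) ^+ (2 ^ N).
pose p N : {poly R} := 'X^m * e N * q N.
have aN0 N : 0 <= alpha / 2 ^+ N by rewrite divr_ge0// exprn_ge0.
have q_refl N : coef_le (q N) (q N).
  rewrite /q; elim: N => [|N IH]; first by rewrite big_ord0; exact: coef_le1.
  by rewrite big_ord_recr /=; apply: coef_leM => //; exact: coef_le_1DZX.
have q_le N : coef_le (q N) (q N.+1).
  rewrite -[q N]mulr1 [q N.+1]big_ord_recr /=; apply: coef_leM; first exact: q_refl.
  by apply: coef_leD; [exact: coef_le1|exact: (@coef_leZXn _ 1)].
(* The exponents are powers of 2 for this step: each factor 1 + 2cX is replaced by its majorant (1 +
   cX)^2 = 1 + 2cX + c^2 X^2. *)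
have e_le N : coef_le (e N) (e N.+1).
  rewrite /e expnS exprM; apply: coef_leX; set c := alpha / 2 ^+ N.+1.
  have -> : alpha / 2 ^+ N = c *+ 2 by rewrite /c exprS; field; rewrite expf_neq0.
  rewrite (_ : _ ^+ 2 = 1 + (c *+ 2) *: 'X + c ^+ 2 *: 'X^2); last first.
    by rewrite sqrrD expr1n mul1r exprZn scalerMnl.
  apply: coef_leD; first by apply: coef_le_1DZX; rewrite mulrn_wge0 ?aN0.
  by apply: coef_leZXn; exact: sqr_ge0.
have p_le N : coef_le (p N) (p N.+1).
  by apply: coef_leM => //; apply: coef_leM => //; exact: coef_le_Xn.
have pL (x : R) : 0 <= x -> (fun N => (p N).[x]) @ \oo --> L x.
  move=> x0; rewrite /L.
  have -> : (fun N => (p N).[x]) = fun N => x ^+ m * (e N).[x] * (q N).[x].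
    by apply/funext => N; rewrite !hornerM hornerXn.
  apply: cvgM; last first.
    have -> : (fun N => (q N).[x]) = fun N => \prod_(j < N) (1 + beta j * x).
      apply/funext => N; rewrite horner_prod; apply: eq_bigr => j _.
      by rewrite !hornerE.
    exact: hQ.
  apply: cvgMr.
  have -> : (fun N => (e N).[x]) = fun N => (1 + alpha * x / 2 ^+ N) ^+ (2 ^ N).
    by apply/funext => N; rewrite !hornerE mulrAC.
  by apply: expR_pow_approx; rewrite mulr_ge0.
have p_horner_le N : (p N).[1] <= (p N.+1).[1].
  pose M := maxn (size (p N)) (size (p N.+1)).
  rewrite (@horner_coef_wide _ M) ?leq_maxl// [leRHS](@horner_coef_wide _ M) ?leq_maxr//.
  by apply: ler_sum => k _; rewrite !expr1n !mulr1; have /andP[] := p_le N k.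
(* A nonnegative coefficient is at most the value at 1, and the values at 1 increase to L(1). *)
have coef_bound N k : (p N)`_k <= L 1.
  apply: le_trans (nondecreasing_seq_le_lim p_horner_le (pL 1 ler01) N).
  pose M := maxn k.+1 (size (p N)).
  rewrite (@horner_coef_wide _ M) ?leq_maxr//.
  rewrite (bigD1 (Ordinal (leq_maxl k.+1 (size (p N)) : (k < M)%N)))//=.
  rewrite expr1n mulr1 lerDl; apply: sumr_ge0 => i _.
  by rewrite expr1n mulr1; have /andP[] := p_le N i.
have /choice[g hg] : forall k, exists l : R, (fun N => (p N)`_k) @ \oo --> l.
  move=> k; have [|//|l hl _] := @nondecreasing_bounded_cvg R (fun N => (p N)`_k) (L 1).
    by move=> N; have /andP[] := p_le N k.
  by exists l.
have pg : approximates p g.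
  by split=> [N k|N k|k]; [have /andP[] := p_le N k|have /andP[] := p_le N k|exact: hg].
exists p, g; split => // [N|x x0].
  apply: nonpos_rootedM; last by apply: nonpos_rooted_prod => j; exact: nonpos_rooted_1DZX.
  apply: nonpos_rootedM; first by apply: nonpos_rootedX; exact: nonpos_rooted_polyX.
  by apply: nonpos_rootedX; exact: nonpos_rooted_1DZX.
by apply: (approximates_series pg x0); exact: pL.
Qed.

Lemma laguerre_approximation (f : nat -> C) : Laguerre f ->
  exists (C0 : C) (p : nat -> {poly R}) (g : nat -> R),
  [/\ C0 != 0, forall N, nonpos_rooted (p N), approximates p g &
    f = fun k => C0 * (g k)%:C].
Proof.
move=> [C0 [m [alpha [beta [alpha0 [beta01 [cbeta [P hP]]]]]]]].
have beta0 j : 0 <= beta j by have /andP[b0 b1] := beta01 j; exact: le_trans b1.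
(* The zero function is written as 1 times zero approximants, so that the constant stays
   invertible. *)
have [C00|C0N] := eqVneq C0 0.
  exists 1, (fun=> 0), (fun=> 0); split => //.
  - by move=> N; exact: nonpos_rooted0.
  - by split => [N k|N k|k] /=; rewrite ?coef0//; exact: cvg_cst.
  apply: (@power_series_unique _ _ _ (fun=> 0)) => x x0.
    by have [_] := hP x%:C; rewrite C00 !mul0r.
  have -> : (fun n => \sum_(k < n) 1 * 0%:C * x%:C ^+ k) = (fun=> 0 : C).
    by apply/funext => n; rewrite big1// => k _; rewrite mulr0 mul0r.
  exact: cvgCF_cst.
pose L (x : R) : R := x ^+ m * expR (alpha * x) * complex.Re (P x%:C).
have PE (x : R) : P x%:C = (complex.Re (P x%:C))%:C /\
    (fun n => \prod_(j < n) (1 + beta j * x)) @ \oo --> complex.Re (P x%:C).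
  have [[h1 h2] _] := hP x%:C.
  have E n : \prod_(j < n) (1 + (beta j)%:C * x%:C) = (\prod_(j < n) (1 + beta j * x))%:C.
    by rewrite rmorph_prod; apply: eq_bigr => j _; rewrite rmorphD rmorphM rmorph1.
  split; last by move: h1; under eq_fun do rewrite E.
  have h0 : (fun n => complex.Im (\prod_(j < n) (1 + (beta j)%:C * x%:C))) = fun=> 0.
    by apply/funext => n; rewrite E.
  rewrite h0 in h2; apply/eqP; rewrite eq_complex eqxx /=; apply/eqP.
  exact: (cvg_unique _ h2 (cvg_cst (0 : R))).
have [|p [g [p_roots pg gL]]] := @laguerre_coef_approximation m alpha beta
  (fun x => complex.Re (P x%:C)) alpha0 beta0.
  by move=> x x0; have [] := PE x.
exists C0, p, g; split => //.
apply: (@power_series_unique _ _ _ (fun x : R => C0 * (L x)%:C)) => x x0.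
  have [_] := hP x%:C; have [-> _] := PE x.
  by rewrite -rmorphM cexp_real /L !rmorphM rmorphXn /= !mulrA.
under eq_fun do under eq_bigr do rewrite -mulrA -rmorphXn -rmorphM.
under eq_fun do rewrite -mulr_sumr -rmorph_sum.
apply: cvgCFM; first exact: cvgCF_cst.
by apply: cvgCF_real; exact: gL.
Qed.

End LaguerreApproximation.

(** * Bounds on phi(Delta) f *)

Section CoefficientBounds.
Variable R : realType.
Local Notation C := R[i].
Local Notation normc := (@Normc.normc R).
Implicit Types (b M : R) (f phi : tseries R).

(** For b > 0 this is [normb b f <= M], kept in real numbers and in a form to which the monotone
    operator applies. *)
Definition coef_bounded (b M : R) (f : tseries R) : Prop :=
  forall k, normc (f k) <= M * expcoef b k.

Lemma expcoef_le (b c : R) n : 0 <= b <= c -> expcoef b n <= expcoef c n.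
Proof.
move=> /andP[b0 bc]; rewrite /expcoef ler_wpM2r ?invr_ge0 ?ler0n//.
by rewrite lerXn2r ?nnegrE// (le_trans b0 bc).
Qed.

Lemma expcoef0 (b : R) : expcoef b 0 = 1.
Proof. by rewrite /expcoef expr0 invr1 mulr1. Qed.

Lemma coef_bounded_ge0 b M f : coef_bounded b M f -> 0 <= M.
Proof. by move=> /(_ 0%N); rewrite expcoef0 mulr1; apply: le_trans; exact: normc_ge0. Qed.

Lemma normb_term b f k M : 0 < b ->
  (b ^- k * normc (Defs.deriv0 f k) <= M) = (normc (f k) <= M * expcoef b k).
Proof.
move=> b0; rewrite /Defs.deriv0 Normc.normcM normc_nat /expcoef.
have bk : 0 < b ^+ k by rewrite exprn_gt0.
have fk : 0 < k`!%:R :> R by rewrite ltr0n fact_gt0.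
rewrite mulrC ler_pdivrMr// mulrA ler_pdivlMr// [leRHS]mulrC.
by rewrite [_ * normc _]mulrC [M * _]mulrC.
Qed.

Lemma normb_le_coef_bounded b M f : 0 < b ->
  (normb b f <= M%:E)%E -> coef_bounded b M f.
Proof.
move=> b0 fM k; rewrite -normb_term// -lee_fin; apply: le_trans fM.
by apply: ereal_sup_ubound; exists k.
Qed.

Lemma coef_bounded_normb_le b M f : 0 < b ->
  coef_bounded b M f -> (normb b f <= M%:E)%E.
Proof.
move=> b0 fM; apply: ge_ereal_sup => _ [k _ <-].
by rewrite lee_fin normb_term.
Qed.

Lemma normb_fin_coef_bounded b f : 0 < b ->
  (normb b f < +oo)%E -> exists M, coef_bounded b M f.
Proof.
move=> b0 ffin; exists (fine (normb b f)); apply: normb_le_coef_bounded => //.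
rewrite fineK// ge0_fin_numE//; apply: le_trans (ereal_sup_ubound _); last by exists 0%N.
by rewrite lee_fin mulr_ge0 ?normc_ge0// invr_ge0 exprn_ge0// ltW.
Qed.

Lemma expcoef_series_cvg (b M x : R) :
  (fun n => \sum_(k < n) M * expcoef b k * x ^+ k) @ \oo --> M * expR (b * x).
Proof.
have -> : (fun n => \sum_(k < n) M * expcoef b k * x ^+ k) =
    fun n => M * series (exp_coeff (b * x)) n.
  apply/funext => n; rewrite /series /= big_mkord mulr_sumr; apply: eq_bigr => k _.
  by rewrite /expcoef /exp_coeff /= exprMn; ring.
by apply: cvgMr; exact: is_cvg_series_exp_coeff.
Qed.

Lemma coef_bounded_entire b M f : coef_bounded b M f -> entire f.
Proof.
move=> fM z; have [k|l fl _] := @abs_series_cvgC R (fun k => f k * z ^+ k)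
    (fun k => M * expcoef b k * normc z ^+ k) _ _ (@expcoef_series_cvg b M (normc z)).
  by rewrite Normc.normcM normcX ler_wpM2r// exprn_ge0// normc_ge0.
by exists l.
Qed.

End CoefficientBounds.

(** * Domination of the defining series *)

Section DeltaSeries.
Variable R : realType.
Variables (theta omega : R).
Local Notation C := R[i].
Local Notation normc := (@Normc.normc R).
Local Notation Dl := (Delta theta omega).
Local Notation sDl := (seqDelta theta omega).
Implicit Types f phi : tseries R.

Lemma DeltaE f n : Dl f n =
  (n.+1%:R * (theta + n%:R))%:C * f n.+1 + (omega * n%:R)%:C * f n.
Proof.
rewrite /Delta /addT /scaleT /Zop /Dop; case: n => [|n].
  by rewrite !rmorphM rmorphD !rmorph_nat /=; ring.
by rewrite !rmorphM rmorphD !rmorph_nat /=; ring.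
Qed.

Lemma iter_Delta_sub k f g n : iter k Dl (subT f g) n = iter k Dl f n - iter k Dl g n.
Proof.
elim: k n => [//|k IH] n; rewrite !iterS !DeltaE !IH.
by move: (_%:C) (_%:C) => x y; ring.
Qed.

Lemma iter_Delta_real k (c : C) (g : nat -> R) n :
  iter k Dl (fun j => c * (g j)%:C) n = c * (iter k sDl g n)%:C.
Proof.
elim: k n => [//|k IH] n; rewrite !iterS DeltaE !IH /seqDelta.
by rewrite !rmorphD !rmorphM; ring.
Qed.

Lemma iter_seqDeltaZ k (M : R) (g : nat -> R) n :
  iter k sDl (fun j => M * g j) n = M * iter k sDl g n.
Proof.
elim: k n => [//|k IH] n; rewrite !iterS /seqDelta !IH; ring.
Qed.

Hypotheses (theta_ge0 : 0 <= theta) (omega_ge0 : 0 <= omega).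

Lemma iter_Delta_le k f (h : nat -> R) n : (forall j, normc (f j) <= h j) ->
  normc (iter k Dl f n) <= iter k sDl h n.
Proof.
move=> fh; elim: k n => [|k IH] n; first exact: fh.
rewrite !iterS DeltaE /seqDelta; apply: le_trans (le_normcD _ _) _.
by rewrite !normcZ_real ?mulr_ge0 ?addr_ge0// lerD// ler_wpM2l// ?mulr_ge0// addr_ge0.
Qed.

(** Both arguments are dominated by multiples of exponential series, and monotonicity of the
    operator dominates each term. K precedes phi and f, so the estimate is a bilinear bound. *)
Lemma phiDelta_bound (a b : R) : 0 <= a -> 0 <= b -> b * qfun omega a < 1 ->
  exists2 K : R, 0 <= K & forall phi f M L,
    coef_bounded a M phi -> coef_bounded b L f ->
    forall n, exists2 l, cvgC (fun N => phiDelta_partial theta omega phi f N n) l &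
      normc l <= M * L * K * expcoef (cconst omega a b) n.
Proof.
move=> a0 b0 abq.
have [K K0 hK] := exp_seqDelta_bound theta_ge0 omega_ge0 a0 b0 abq.
exists K => // phi f M L phiM fL n.
have M0 := coef_bounded_ge0 phiM; have L0 := coef_bounded_ge0 fL.
have e0 k := expcoef_ge0 k b0.
pose w k := M * L * (expcoef a k * iter k sDl (expcoef b) n).
have w0 k : 0 <= w k.
  rewrite mulr_ge0 ?(mulr_ge0 M0 L0)// mulr_ge0 ?expcoef_ge0//.
  exact: (iter_seqDelta_ge0 theta_ge0 omega_ge0 k e0).
have [|N|s ws sle] := @nondecreasing_bounded_cvg R (fun N => \sum_(k < N) w k)
    (M * L * K * expcoef (cconst omega a b) n).
- by move=> N; rewrite big_ord_recr /= lerDl.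
- by rewrite /w -mulr_sumr -[leRHS]mulrA; exact: (ler_wpM2l (mulr_ge0 M0 L0) (hK N n)).
have [k|l hl ls] := @abs_series_cvgC R (fun k => phi k * iter k Dl f n) w s _ ws.
  rewrite Normc.normcM /w; apply: (@le_trans _ _ ((M * expcoef a k) *
      iter k sDl (fun j => L * expcoef b j) n)).
    by rewrite ler_pM ?normc_ge0//; exact: iter_Delta_le.
  by rewrite iter_seqDeltaZ le_eqVlt; apply/orP; left; apply/eqP; ring.
by exists l => //; exact: le_trans sle.
Qed.

End DeltaSeries.

Section Perturbation.
Variable R : realType.
Variables (omega a b : R).
Hypothesis b_ge0 : 0 <= b.
Hypothesis abq : b * qfun omega a < 1.

Lemma cconst_ge0 : 0 <= cconst omega a b.
Proof. by rewrite divr_ge0 ?mulr_ge0 ?expR_ge0// subr_ge0 ltW. Qed.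

(** Both requirements are open conditions satisfied at (a, b), so adding 1/(n+1) to both parameters
    works for large n. *)
Lemma parameters_perturb (c' : R) : cconst omega a b < c' ->
  exists a' b', [/\ a < a', b < b', b' * qfun omega a' < 1 & cconst omega a' b' <= c'].
Proof.
move=> cc'; pose an n := a + harmonic n; pose bn n := b + harmonic n.
have h0 : @harmonic R @ \oo --> (0 : R) := cvg_harmonic.
have an_cvg : an @ \oo --> a.
  by rewrite -[X in _ --> X]addr0; apply: cvgD => //; exact: cvg_cst.
have bn_cvg : bn @ \oo --> b.
  by rewrite -[X in _ --> X]addr0; apply: cvgD => //; exact: cvg_cst.
have q_cont : continuous (qfun omega).
  move=> t; apply: differentiable_continuous; apply/derivable1_diffP.
  by have [] := is_derive_qfun omega t.
have q_cvg : (fun n => qfun omega (an n)) @ \oo --> qfun omega a.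
  exact: cvg_compose.
have bq_cvg : (fun n => bn n * qfun omega (an n)) @ \oo --> b * qfun omega a.
  exact: cvgM.
have c_cvg : (fun n => cconst omega (an n) (bn n)) @ \oo --> cconst omega a b.
  apply: cvgM; last first.
    apply: cvgV; first by rewrite subr_eq0 gt_eqF.
    by apply: cvgB => //; exact: cvg_cst.
  apply: cvgM => //; apply: cvg_compose; first exact: continuous_expR.
  by apply: cvgM => //; exact: cvg_cst.
have n1 := cvgr_lt _ bq_cvg _ abq; have n2 := cvgr_le _ c_cvg _ cc'.
have [n [hn1 hn2]] := filter_ex (filterI (n1 _) (n2 _)).
by exists (an n), (bn n); split => //; rewrite ltrDl invr_gt0.
Qed.

End Perturbation.

(** * Membership in the target space and continuity *)

Section Continuity.
Variable R : realType.
Variables (theta omega a b : R).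
Hypotheses (theta_ge0 : 0 <= theta) (omega_ge0 : 0 <= omega).
Hypotheses (a_ge0 : 0 <= a) (b_ge0 : 0 <= b) (abq : b * qfun omega a < 1).
Local Notation C := R[i].
Local Notation normc := (@Normc.normc R).
Implicit Types (f phi : tseries R).

Lemma inA_coef_bounded a' b' phi : a' < b' -> 0 <= a' -> inA a' phi ->
  exists M : R, coef_bounded b' M phi.
Proof.
by move=> ab a0 [_ /(_ b' ab)]; apply: normb_fin_coef_bounded; exact: le_lt_trans ab.
Qed.

Lemma phiDelta_estimate (c' : R) : cconst omega a b < c' ->
  exists a' b' K : R, [/\ a < a', b < b', 0 <= K & forall phi f M L,
    coef_bounded a' M phi -> coef_bounded b' L f -> forall n,
    cvgC (fun N => phiDelta_partial theta omega phi f N n) (phiDelta theta omega phi f n) /\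
    normc (phiDelta theta omega phi f n) <= M * L * K * expcoef c' n].
Proof.
move=> cc'; have [a' [b' [aa' bb' abq' cle]]] := parameters_perturb abq cc'.
have a'0 : 0 <= a' by exact: le_trans a_ge0 (ltW aa').
have b'0 : 0 <= b' by exact: le_trans b_ge0 (ltW bb').
have [K K0 hK] := phiDelta_bound theta_ge0 omega_ge0 a'0 b'0 abq'.
exists a', b', K; split => // phi f M L phiM fL n.
have [l hl lM] := hK _ _ _ _ phiM fL n; rewrite /phiDelta (cvgC_climn hl); split => //.
apply: le_trans lM _; rewrite ler_wpM2l//.
  by rewrite !mulr_ge0// ?(coef_bounded_ge0 phiM) ?(coef_bounded_ge0 fL).
by apply: expcoef_le; rewrite cle cconst_ge0.
Qed.

Lemma phiDelta_inA phi f : inA a phi -> inA b f ->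
  inA (cconst omega a b) (phiDelta theta omega phi f).
Proof.
move=> hphi hf; have c0 := cconst_ge0 b_ge0 abq.
have bounded c' : cconst omega a b < c' ->
    exists M, coef_bounded c' M (phiDelta theta omega phi f).
  move=> cc'; have [a' [b' [K [aa' bb' K0 hK]]]] := phiDelta_estimate cc'.
  have [M phiM] := inA_coef_bounded aa' a_ge0 hphi.
  have [L fL] := inA_coef_bounded bb' b_ge0 hf.
  by exists (M * L * K) => n; have [] := hK _ _ _ _ phiM fL n.
split => [|c' cc'].
  have [|M hM] := bounded (cconst omega a b + 1); first by rewrite ltrDl.
  exact: coef_bounded_entire hM.
have [M hM] := bounded c' cc'.
apply: le_lt_trans (coef_bounded_normb_le (le_lt_trans c0 cc') hM) _.
exact: ltry.
Qed.

Lemma phiDelta_laguerre phi f : inLa a phi -> inLa b f ->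
  Laguerre (phiDelta theta omega phi f).
Proof.
move=> [Lphi Aphi] [Lf Af].
have [C1 [P [u [C10 P_roots Pu phiE]]]] := laguerre_approximation Lphi.
have [C2 [Q [v [C20 Q_roots Qv fE]]]] := laguerre_approximation Lf.
have u0 k : 0 <= u k := approximates_ge0 k Pu.
have v0 k : 0 <= v k := approximates_ge0 k Qv.
have [|a' [b' [K [aa' bb' K0 hK]]]] := @phiDelta_estimate (cconst omega a b + 1).
  by rewrite ltrDl.
have [M phiM] := inA_coef_bounded aa' a_ge0 Aphi.
have [L fL] := inA_coef_bounded bb' b_ge0 Af.
pose C0 := C1 * C2; have C00 : C0 != 0 by rewrite mulf_neq0.
(* After division by the constant the partial sums are real, so the real part loses nothing; [gE]
   records this. *)
pose g n := complex.Re (C0^-1 * phiDelta theta omega phi f n).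
have partialE N n : phiDelta_partial theta omega phi f N n =
    C0 * (\sum_(k < N) u k * iter k (seqDelta theta omega) v n)%:C.
  rewrite /phiDelta_partial rmorph_sum mulr_sumr; apply: eq_bigr => k _.
  by rewrite fE iter_Delta_real phiE rmorphM /C0 mulrACA.
have scaled n : cvgC (fun N => (\sum_(k < N) u k * iter k (seqDelta theta omega) v n)%:C)
    (C0^-1 * phiDelta theta omega phi f n).
  have [h _] := hK _ _ _ _ phiM fL n.
  have -> : (fun N => (\sum_(k < N) u k * iter k (seqDelta theta omega) v n)%:C) =
      fun N => C0^-1 * phiDelta_partial theta omega phi f N n.
    by apply/funext => N; rewrite partialE mulKf.
  by apply: cvgCFM => //; exact: cvgCF_cst.
have g_cvg n : (fun N => \sum_(k < N) u k * iter k (seqDelta theta omega) v n) @ \oo --> g n.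
  by have [] := scaled n.
have gE : phiDelta theta omega phi f = fun n => C0 * (g n)%:C.
  apply/funext => n; rewrite -[LHS](mulVKf C00); congr (_ * _).
  exact: (cvgCF_unique (scaled n) (cvgCF_real (g_cvg n))).
have app := approximates_polyOp theta_ge0 omega_ge0 Pu Qv g_cvg.
rewrite gE; apply: (laguerre_of_approximation _ _ app).
  by move=> N; exact: nonpos_rooted_polyOp.
move=> x x0; pose D := normc C0^-1 * (M * L * K).
have gD k : normc (g k * x ^+ k)%:C <= D * expcoef (cconst omega a b + 1) k * x ^+ k.
  rewrite normc_real normrM [`|x ^+ k|]ger0_norm ?exprn_ge0// ler_wpM2r ?exprn_ge0//.
  apply: le_trans (Re_le_normc _) _; rewrite Normc.normcM /D -mulrA ler_wpM2l ?normc_ge0//.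
  by have [] := hK _ _ _ _ phiM fL k.
have [l [hl _] _] := abs_series_cvgC gD (@expcoef_series_cvg R _ D x).
by exists (complex.Re l); move: hl; under eq_fun do rewrite Re_sum.
Qed.

Lemma phiDelta_continuous phi0 f0 (c' eps : R) : inA a phi0 -> inA b f0 ->
  cconst omega a b < c' -> 0 < eps ->
  exists (a' b' delta : R), [/\ a < a', b < b' & 0 < delta] /\
    forall phi f : tseries R, inA a phi -> inA b f ->
      (normb a' (subT phi phi0) < delta%:E)%E ->
      (normb b' (subT f f0) < delta%:E)%E ->
      (normb c' (subT (phiDelta theta omega phi f)
                      (phiDelta theta omega phi0 f0)) < eps%:E)%E.
Proof.
move=> Aphi0 Af0 cc' eps0.
have [a' [b' [K [aa' bb' K0 hK]]]] := phiDelta_estimate cc'.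
have [M phi0M] := inA_coef_bounded aa' a_ge0 Aphi0.
have [L f0L] := inA_coef_bounded bb' b_ge0 Af0.
have M0 := coef_bounded_ge0 phi0M; have L0 := coef_bounded_ge0 f0L.
have a'0 : 0 < a' by exact: le_lt_trans aa'.
have b'0 : 0 < b' by exact: le_lt_trans bb'.
have c'0 : 0 < c' by apply: le_lt_trans cc'; exact: cconst_ge0.
(* The two halves of the difference cost delta (L + delta) K and M delta K, and delta <= 1 bounds
   their sum by delta S. The final 1 keeps S positive, and eps / 2 restores strictness after the
   supremum. *)
pose S := K * (M + L + 1) + 1.
have S0 : 0 < S by rewrite ltr_wpDl// mulr_ge0// !addr_ge0.
pose delta := Num.min 1 (eps / (2 * S)).
have delta0 : 0 < delta by rewrite lt_min ltr01 divr_gt0// mulr_gt0.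
have delta1 : delta <= 1 by rewrite ge_min lexx.
have deltaS : delta * S <= eps / 2.
  apply: (@le_trans _ _ (eps / (2 * S) * S)).
    by rewrite ler_wpM2r ?(ltW S0)// ge_min lexx orbT.
  by rewrite le_eqVlt; apply/orP; left; apply/eqP; field; rewrite gt_eqF.
exists a', b', delta; split => // phi f Aphi Af dphi df.
have phid := normb_le_coef_bounded a'0 (ltW dphi).
have fd := normb_le_coef_bounded b'0 (ltW df).
have fL : coef_bounded b' (L + delta) f.
  move=> k; rewrite -[f k](subrK (f0 k)) mulrDl addrC.
  by apply: le_trans (le_normcD _ _) _; apply: lerD; [exact: f0L|exact: fd].
have phiM : coef_bounded a' (M + delta) phi.
  move=> k; rewrite -[phi k](subrK (phi0 k)) mulrDl addrC.
  by apply: le_trans (le_normcD _ _) _; apply: lerD; [exact: phi0M|exact: phid].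
have split_diff n : subT (phiDelta theta omega phi f) (phiDelta theta omega phi0 f0) n =
    phiDelta theta omega (subT phi phi0) f n + phiDelta theta omega phi0 (subT f f0) n.
  have [h1 _] := hK _ _ _ _ phiM fL n; have [h2 _] := hK _ _ _ _ phi0M f0L n.
  have [h3 _] := hK _ _ _ _ phid fL n; have [h4 _] := hK _ _ _ _ phi0M fd n.
  apply: (cvgCF_unique (cvgCFB h1 h2)).
  have -> : (fun N => phiDelta_partial theta omega phi f N n -
      phiDelta_partial theta omega phi0 f0 N n) = fun N =>
      phiDelta_partial theta omega (subT phi phi0) f N n +
      phiDelta_partial theta omega phi0 (subT f f0) N n.
    apply/funext => N; rewrite /phiDelta_partial -sumrB -big_split.
    apply: eq_bigr => k _; rewrite iter_Delta_sub /subT /=.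
    by move: (iter _ _ f _) (iter _ _ f0 _) => x y; ring.
  exact: cvgCFD.
apply: (@le_lt_trans _ _ (eps / 2)%:E); last by rewrite lte_fin; lra.
apply: coef_bounded_normb_le => // n; rewrite split_diff.
have [_ h3] := hK _ _ _ _ phid fL n; have [_ h4] := hK _ _ _ _ phi0M fd n.
apply: le_trans (le_normcD _ _) _; apply: le_trans (lerD h3 h4) _.
rewrite -mulrDl ler_wpM2r ?(expcoef_ge0 _ (ltW c'0))//.
apply: le_trans deltaS; rewrite /S.
rewrite -mulrDl [M * delta]mulrC -mulrDr -mulrA ler_wpM2l ?(ltW delta0)//.
rewrite mulrC; apply: (@le_trans _ _ (K * (M + L + 1))); last by rewrite lerDl.
by rewrite ler_wpM2l//; lra.
Qed.

End Continuity.

Theorem theorem3 (R : realType) (theta omega a b : R) :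
  0 <= theta -> 0 <= omega -> 0 <= a -> 0 <= b ->
  b * qfun omega a < 1 ->
  let c := cconst omega a b in
  (* well-defined: the defining series converges (coefficientwise) *)
  (forall phi f : tseries R, inLa a phi -> inLa b f ->
     forall n : nat, exists l : R[i],
       cvgC (fun N => phiDelta_partial theta omega phi f N n) l) /\
  (* maps L^+_a x L^+_b into L^+_c *)
  (forall phi f : tseries R, inLa a phi -> inLa b f ->
     inLa c (phiDelta theta omega phi f)) /\
  (* continuity for the Frechet topologies (norms ||.||_{a'}, a' > a, etc.) *)
  (forall phi0 f0 : tseries R, inLa a phi0 -> inLa b f0 ->
     forall (c' eps : R), c < c' -> 0 < eps ->
     exists (a' b' delta : R), [/\ a < a', b < b' & 0 < delta] /\
       forall phi f : tseries R, inLa a phi -> inLa b f ->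
         (normb a' (subT phi phi0) < delta%:E)%E ->
         (normb b' (subT f f0) < delta%:E)%E ->
         (normb c' (subT (phiDelta theta omega phi f)
                         (phiDelta theta omega phi0 f0)) < eps%:E)%E).
Proof.
move=> theta0 omega0 a0 b0 abq c; split; last split.
- move=> phi f [_ Aphi] [_ Af] n.
  (* Any index above c would do, as only the convergence part of the estimate is used. *)
  have [|a' [b' [K [aa' bb' _ hK]]]] :=
    @phiDelta_estimate R _ _ _ _ theta0 omega0 a0 b0 abq (c + 1); first by rewrite ltrDl.
  have [M phiM] := inA_coef_bounded aa' a0 Aphi.
  have [L fL] := inA_coef_bounded bb' b0 Af.
  by have [h _] := hK _ _ _ _ phiM fL n; exists (phiDelta theta omega phi f n).
- move=> phi f hphi hf; split; first exact: (phiDelta_laguerre theta0 omega0 a0 b0 abq).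
  by case: hphi hf => [_ Aphi] [_ Af]; exact: (phiDelta_inA theta0 omega0 a0 b0 abq).
- move=> phi0 f0 [_ Aphi0] [_ Af0] c' eps cc' eps0.
  have [a' [b' [delta [hpos hcont]]]] :=
    phiDelta_continuous theta0 omega0 a0 b0 abq Aphi0 Af0 cc' eps0.
  exists a', b', delta; split => // phi f [_ Aphi] [_ Af].
  exact: hcont.
Qed.
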